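(* Let $\lambda\in\mathbb{C}\setminus\{0\}$, let $f(z)=-2z^2$, let $f^n$ denote the $n$-th iterate of $f$, and write $\tilde\lambda=f(\lambda)$ and $\tilde{\tilde\lambda}=(f\circ f)(\lambda)$. (1) If $|\lambda|<\frac12$, then $|f^n(\lambda)|<\frac12$ for all integers $n\ge 0$, so that $G_{\tilde\lambda}$ is non-discrete and $G_{f^n(\lambda)}$ is neither discrete nor classical T-Schottky for any $n>0$. (2) If $|\lambda|>\frac{\sqrt2}{2}$, then $|\tilde\lambda|>1$ and $|\tilde{\tilde\lambda}|>2$, so that $G_{\tilde{\tilde\lambda}}$ is classical T-Schottky. (3) If $\frac12<|\lambda|<\frac{\sqrt2}{2}$, then there is a smallest integer $n\ge 1$ such that $G_{f^n(\lambda)}$ is classical T-Schottky but $G_{f^{n-1}(\lambda)}$ is not. (4) For each $\lambda$ with $\frac12<|\lambda|<\frac{\sqrt2}{2}$ there is a unique integer $n$ such that $G_\lambda$ is $n$th classical T-Schottky.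
   Context: For $\lambda\in\mathbb{C}\setminus\{0\}$, $G_\lambda=\langle S,T_\lambda\rangle$ is the subgroup of $PSL(2,\mathbb{C})$ generated by (the classes of) $S=\begin{pmatrix}1&0\\1&1\end{pmatrix}$ and $T_\lambda=\begin{pmatrix}1&2\lambda\\0&1\end{pmatrix}$, acting on the Riemann sphere $\hat{\mathbb{C}}$ by Möbius transformations. T-Schottky groups are defined as Schottky groups, except that arbitrary tangencies are allowed among the defining curves. Precisely (rank two): a group is T-Schottky if it has generators $g_1,g_2$ for which there are Jordan curves $C_1,C_2,D_1,D_2$ in $\hat{\mathbb{C}}$, each with a chosen complementary component called its interior, such that the four interiors are pairwise disjoint (the curves themselves may be tangent, at parabolic fixed points or at other points, whether or not they are paired), and $g_1(C_1)=C_2$, $g_2(D_1)=D_2$, with $g_1$ (resp. $g_2$) mapping the interior of $C_1$ (resp. $D_1$) onto the exterior of $C_2$ (resp. $D_2$). It is classical T-Schottky if for some choice of generators all four curves can be taken to be Euclidean circles in $\hat{\mathbb{C}}$ (straight lines through $\infty$ included). For an integer $n\ge1$, $G_\lambda$ is called $n$th classical T-Schottky if $G_{f^n(\lambda)}$ is classical T-Schottky but $G_{f^{n-1}(\lambda)}$ is not, where $f(z)=-2z^2$. *)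

(* Defs.v *)
(* MathComp / MathComp-Analysis; the complex numbers are R[i] for an arbitrary
   R : realType. *)
From HB Require Import structures.
From mathcomp Require Import all_boot all_order all_algebra.
From mathcomp Require Import complex.
From mathcomp Require Import all_classical all_reals all_analysis.

Set Implicit Arguments.
Unset Strict Implicit.
Unset Printing Implicit Defensive.

Import Order.TTheory GRing.Theory Num.Theory.
Import numFieldNormedType.Exports.

Local Open Scope classical_set_scope.
Local Open Scope ring_scope.
Local Open Scope complex_scope.

(* R[i]^o is R[i] with its usual topology; None is the point at infinity. *)
Notation sphere R := (one_point_compactification (complex R)^o).

Definition mx22 (R : realType) (a b c d : R[i]) : 'M[R[i]]_2 :=
  \matrix_(i < 2, j < 2) if i == 0 then (if j == 0 then a else b)
                         else (if j == 0 then c else d).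

Definition mobius (R : realType) (g : 'M[R[i]]_2) (w : sphere R) : sphere R :=
  match w with
  | Some z => if g 1 0 * z + g 1 1 == 0 then None
              else Some ((g 0 0 * z + g 0 1) / (g 1 0 * z + g 1 1))
  | None => if g 1 0 == 0 then None else Some (g 0 0 / g 1 0)
  end.

(* A subset of PSL(2,C) = SL(2,C)/{1,-1} is represented by its full preimage in
   SL(2,C), that is, by a set of matrices of determinant 1 stable under -1. *)
Definition PSL2_subgroup (R : realType) (H : set 'M[R[i]]_2) : Prop :=
  [/\ forall g, H g -> \det g = 1,
      H 1%:M,
      forall g h, H g -> H h -> H (g *m h),
      forall g, H g -> H (invmx g) &
      forall g, H g -> H (- g)].

Definition PSL2_generated (R : realType) (g h : 'M[R[i]]_2) :
  set 'M[R[i]]_2 := smallest (@PSL2_subgroup R) [set g; h].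

(* The topology of PSL(2,C) is the quotient of that of SL(2,C) by the finite
   group {1,-1}, so a subset is discrete iff its full preimage is. *)
Definition PSL2_discrete (R : realType) (H : set 'M[R[i]]_2) : Prop :=
  (H : set 'M[(R[i])^o]_2) `<=` isolated (H : set 'M[(R[i])^o]_2).

Definition S_mx (R : realType) : 'M[R[i]]_2 := mx22 1 0 1 1.

Definition T_mx (R : realType) (lam : R[i]) : 'M[R[i]]_2 :=
  mx22 1 (2 * lam) 0 1.

Definition G_ (R : realType) (lam : R[i]) : set 'M[R[i]]_2 :=
  PSL2_generated (S_mx R) (T_mx lam).

Definition circle (R : realType) (K : set (sphere R)) : Prop :=
  (exists (c : R[i]) (r : R),
      0 < r /\ K = Some @` [set z : R[i] | `|z - c| = r%:C]) \/
  (exists p v : R[i],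
      v != 0 /\ K = None |` (Some @` [set p + t%:C * v | t in [set: R]])).

Definition complementary_component (R : realType) (K U : set (sphere R)) :
  Prop := exists2 w, ~ K w & U = connected_component (~` K) w.

(* U being one complementary component of the circle K, the exterior is the
   other one. *)
Definition exterior (R : realType) (K U : set (sphere R)) : set (sphere R) :=
  ~` (K `|` U).

Definition pairs (R : realType) (g : 'M[R[i]]_2) (K1 U1 K2 U2 : set (sphere R)) :
  Prop := mobius g @` K1 = K2 /\ mobius g @` U1 = exterior K2 U2.

Definition classical_T_Schottky (R : realType) (H : set 'M[R[i]]_2) : Prop :=
  exists g1 g2 : 'M[R[i]]_2,
    [/\ \det g1 = 1, \det g2 = 1, H = PSL2_generated g1 g2 &
    exists C1 C2 D1 D2 U1 U2 V1 V2 : set (sphere R),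
    [/\ [/\ circle C1, circle C2, circle D1 & circle D2],
        [/\ complementary_component C1 U1, complementary_component C2 U2,
            complementary_component D1 V1 & complementary_component D2 V2],
        [/\ [disjoint U1 & U2], [disjoint V1 & V2] &
            [/\ [disjoint U1 & V1], [disjoint U1 & V2],
                [disjoint U2 & V1] & [disjoint U2 & V2]]],
        pairs g1 C1 U1 C2 U2 &
        pairs g2 D1 V1 D2 V2]].

Definition f (R : realType) (z : R[i]) : R[i] := - 2 * z ^+ 2.

Definition nth_classical_T_Schottky (R : realType) (lam : R[i]) (n : nat) :
  Prop :=
  [/\ (1 <= n)%N, classical_T_Schottky (G_ (iter n (@f R) lam)) &
      ~ classical_T_Schottky (G_ (iter n.-1 (@f R) lam))].

(* Main.v *)
Require Import Defs.
From HB Require Import structures.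
From mathcomp Require Import all_boot all_order all_algebra.
From mathcomp Require Import complex.
From mathcomp Require Import all_classical all_reals all_analysis.
From mathcomp Require Import ring lra zify.

(** The theorem rests on two facts about the group generated by [S_mx] and
    [T_mx lam], together with the identity [|f z| = 2 |z|^2].

    - If the group is classical T-Schottky then [|lam| >= 1]
      ([classical_T_Schottky_norm_ge1]), and if [|lam| >= 2] then it is classical
      T-Schottky ([classical_T_Schottky_norm_ge2]).
    - If [0 < |lam| < 1/2] then the group is not discrete
      ([small_not_discrete]), by Shimizu's argument: the iterated conjugates
      [A_(n+1) = A_n T A_n^-1] of [T] started at [S] converge to [T].

    When [|lam| < 1/2] all iterates keep modulus less than [1/2].  When
    [|lam| > 1/2] the moduli of the iterates tend to infinity; an iterate that is
    classical T-Schottky has modulus at least 1, so its image has modulus at least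
    2 and is again classical T-Schottky.  Hence along the orbit the property
    switches on exactly once, and not at the start if
    [|lam| < sqrt 2 / 2 < 1].

    The lower bound [|lam| >= 1] has to be proved for arbitrary generators
    [g1], [g2] and arbitrary circles.  A round disc of the sphere is encoded by a
    Hermitian matrix [M] of determinant -1, the disc being the set where the
    Hermitian form is negative; matrices act on such [M] by congruence, and the
    polarisation [ip] of minus the determinant is an invariant product.  Disjoint
    discs satisfy [ip M N <= -1] and nested ones [1 <= ip M N] ([disjoint_ip],
    [nested_ip]).  The four discs play ping-pong along reduced words, so that any
    two translates [P], [Q] of them satisfy [1 <= |ip P Q|] ([noncrossing]).

    The parabolic [T] is conjugate to a cyclically reduced word, and the first
    letter of that word provides a translate [P] with [T P] nested in [P].
    Then [1 <= ip (T P) P], and this inequality forces [P] to be a half-plane.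
    In the same way [S] provides a translate [Q] whose boundary passes through 0.
    The powers of [T] and of [S] move [P] and [Q] through two arithmetic
    progressions [d + k tau] and [a + m sigma], where [|tau sigma| <= 8 |lam|], and
    non-crossing becomes
    [2 <= |2 c - (d + k tau) (a + m sigma)|] for all integers [k], [m], with
    [|c| <= 1].  If one progression avoids 0, then [8 <= |tau sigma|]
    ([progressions]) and the bound follows.  If each meets 0, then [P] and [Q] can
    be moved to half-planes bounded by one and the same line through 0 and infinity,
    and [parabolic_axis] shows moreover that [T] and [S] are conjugate to single
    letters; comparing the two conjugations gives [T = S] or [T = S^-1] up to
    sign, which is absurd. *)

Import Order.TTheory GRing.Theory Num.Theory.
Import numFieldNormedType.Exports.

Local Open Scope classical_set_scope.
Local Open Scope ring_scope.
Local Open Scope complex_scope.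

Set Implicit Arguments.
Unset Strict Implicit.
Unset Printing Implicit Defensive.

Local Notation "x ^*" := (conjc x) : ring_scope.

(** * Two-by-two matrices and Hermitian forms *)

Definition ctr (R : realType) m n (A : 'M[R[i]]_(m, n)) := (map_mx (@conjc R) A)^T.

(** The value of the Hermitian form of [M] at [x]; taking the real part makes it a real
    number, at no loss when [M] is Hermitian. *)
Definition hval (R : realType) (M : 'M[R[i]]_2) (x : 'cV[R[i]]_2) : R :=
  complex.Re ((ctr x *m M *m x) 0 0).

Definition herm (R : realType) (M : 'M[R[i]]_2) := ctr M = M.

Definition cvec (R : realType) (x y : R[i]) : 'cV[R[i]]_2 :=
  \col_i if i == 0 then x else y.

(** Congruence by the inverse, so that the form of [act g M] at [g *m x] is that of [M]
    at [x]: the matrix [g] carries the disc of [M] onto the disc of [act g M]. *)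
Definition act (R : realType) (g M : 'M[R[i]]_2) := ctr (invmx g) *m M *m invmx g.

Lemma ord2_cases (i : 'I_2) : i = 0 \/ i = 1.
Proof. by case: i => [[|[|k]] Hk] //; [left|right]; apply: val_inj. Qed.

Lemma sum_ord2 (V : zmodType) (F : 'I_2 -> V) : \sum_i F i = F 0 + F 1.
Proof. by rewrite !big_ord_recl big_ord0 addr0; congr (_ + F _); apply: val_inj. Qed.

Lemma matrix2P (T : Type) (A B : 'M[T]_2) : A 0 0 = B 0 0 -> A 0 1 = B 0 1 ->
  A 1 0 = B 1 0 -> A 1 1 = B 1 1 -> A = B.
Proof.
by move=> e1 e2 e3 e4; apply/matrixP => i j; case: (ord2_cases i) => ->; case: (ord2_cases j) => ->.
Qed.

Lemma mx22E (R : realType) (a b c d : R[i]) :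
  (mx22 a b c d 0 0 = a) * (mx22 a b c d 0 1 = b) *
  (mx22 a b c d 1 0 = c) * (mx22 a b c d 1 1 = d).
Proof. by rewrite !mxE /=. Qed.

Lemma mx22_eta (R : realType) (M : 'M[R[i]]_2) :
  M = mx22 (M 0 0) (M 0 1) (M 1 0) (M 1 1).
Proof. by apply: matrix2P; rewrite mx22E. Qed.

Lemma mulmx22 (R : realType) (a b c d a' b' c' d' : R[i]) :
  mx22 a b c d *m mx22 a' b' c' d' =
  mx22 (a * a' + b * c') (a * b' + b * d') (c * a' + d * c') (c * b' + d * d').
Proof. by apply: matrix2P; rewrite mxE sum_ord2 !mx22E. Qed.

Lemma det22 (R : realType) (M : 'M[R[i]]_2) :
  \det M = M 0 0 * M 1 1 - M 0 1 * M 1 0.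
Proof.
rewrite (expand_det_row _ 0) sum_ord2 /cofactor !det_mx11 !mxE /=.
have -> : lift 0 0 = 1 :> 'I_2 by apply: val_inj.
have -> : lift 1 0 = 0 :> 'I_2 by apply: val_inj.
by rewrite !expr0 expr1 mul1r mulN1r mulrN.
Qed.

Lemma hermE (R : realType) (M : 'M[R[i]]_2) : herm M ->
  exists (a d : R) (b : R[i]), M = mx22 a%:C b b^* d%:C.
Proof.
move=> hM; have e i j : (M j i)^* = M i j by rewrite -{2}hM !mxE.
have r i : M i i = (complex.Re (M i i))%:C.
  by move: (e i i); case: (M i i) => u v [] h /=; congr (_ +i* _); lra.
exists (complex.Re (M 0 0)), (complex.Re (M 1 1)), (M 0 1).
by rewrite -!r e -mx22_eta.
Qed.

Lemma hvalE (R : realType) (a d : R) (b x y : R[i]) :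
  hval (mx22 a%:C b b^* d%:C) (cvec x y) =
  a * complex.Re (x * x^*) + 2 * complex.Re (x^* * b * y) + d * complex.Re (y * y^*).
Proof.
rewrite /hval !(mxE, sum_ord2) /=; case: b => p q; case: x => x1 x2; case: y => y1 y2.
by rewrite /=; ring.
Qed.

Lemma cvec_eta (R : realType) (x : 'cV[R[i]]_2) : x = cvec (x 0 0) (x 1 0).
Proof.
by apply/matrixP => i j; rewrite mxE ord1; case: (ord2_cases i) => ->.
Qed.

Lemma det_herm (R : realType) (a d : R) (b : R[i]) :
  complex.Re (\det (mx22 a%:C b b^* d%:C)) = a * d - complex.Re (b * b^*).
Proof. by rewrite det22 !mx22E; case: b => p q /=; ring. Qed.

Lemma sqr_ReIm_gt0 (R : realType) (z : R[i]) : z != 0 ->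
  0 < complex.Re z ^+ 2 + complex.Im z ^+ 2.
Proof.
rewrite eq_complex => z0.
by rewrite lt_neqAle addr_ge0 ?sqr_ge0 // andbT eq_sym paddr_eq0 ?sqr_ge0 // !sqrf_eq0.
Qed.

(** Continuity at 0 of a quadratic polynomial, in the only form in which limits are
    taken below. *)
Lemma quadratic_ge0_at0 (R : realType) (A B C : R) :
  (forall e, 0 < e -> e <= 1 -> 0 <= A + B * e + C * e ^+ 2) -> 0 <= A.
Proof.
move=> h; rewrite leNgt; apply/negP => A0.
pose K := `|B| + `|C| + 1; have K0 : 0 < K by rewrite ltr_wpDl// addr_ge0.
pose e := Num.min 1 (- A / (2 * K)).
have e0 : 0 < e by rewrite lt_min ltr01/= divr_gt0 ?mulr_gt0// oppr_gt0.
have e1 : e <= 1 by rewrite ge_min lexx.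
have e2 : e * (2 * K) <= - A.
  by rewrite -ler_pdivlMr ?mulr_gt0// ge_min lexx orbT.
have := h e e0 e1.
have b1 : B * e <= `|B| * e by apply: ler_wpM2r; [exact: ltW|exact: ler_norm].
have b2 : C * e ^+ 2 <= `|C| * e.
  apply: (@le_trans _ _ (`|C| * e ^+ 2)); first by apply: ler_wpM2r;
    [exact: sqr_ge0|exact: ler_norm].
  by rewrite ler_wpM2l// expr2 ger_pMr.
by rewrite /K in e2 *; nra.
Qed.

(** * Round discs as Hermitian forms of determinant -1 *)

Lemma ctrM (R : realType) m n p (A : 'M[R[i]]_(m, n)) (B : 'M[R[i]]_(n, p)) :
  ctr (A *m B) = ctr B *m ctr A.
Proof. by rewrite /ctr map_mxM trmx_mul. Qed.

Lemma ctrK (R : realType) m n (A : 'M[R[i]]_(m, n)) : ctr (ctr A) = A.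
Proof. by apply/matrixP => i j; rewrite !mxE conjcK. Qed.

Lemma ctrN (R : realType) m n (A : 'M[R[i]]_(m, n)) : ctr (- A) = - ctr A.
Proof. by rewrite /ctr map_mxN linearN. Qed.

Lemma hermN (R : realType) (M : 'M[R[i]]_2) : herm M -> herm (- M).
Proof. by rewrite /herm ctrN => ->. Qed.

Lemma herm_congr (R : realType) (P M : 'M[R[i]]_2) :
  herm M -> herm (ctr P *m M *m P).
Proof. by move=> hM; rewrite /herm !ctrM ctrK hM mulmxA. Qed.

Lemma hval_congr (R : realType) (P M : 'M[R[i]]_2) x :
  hval (ctr P *m M *m P) x = hval M (P *m x).
Proof. by rewrite /hval ctrM !mulmxA. Qed.

Lemma hvalN (R : realType) (M : 'M[R[i]]_2) x : hval (- M) x = - hval M x.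
Proof. by rewrite /hval mulmxN mulNmx mxE; case: (_ 0 0). Qed.

Lemma det_ctr (R : realType) (P : 'M[R[i]]_2) : \det (ctr P) = (\det P)^*.
Proof. by rewrite /ctr det_tr det_map_mx. Qed.

Lemma detN2 (R : realType) (M : 'M[R[i]]_2) : \det (- M) = \det M.
Proof. by rewrite !det22 !mxE !mulrNN. Qed.

Lemma unit_det1 (R : realType) (g : 'M[R[i]]_2) : \det g = 1 -> g \in unitmx.
Proof. by rewrite unitmxE => ->; rewrite unitr1. Qed.

Lemma det_invmx1 (R : realType) (g : 'M[R[i]]_2) : \det g = 1 -> \det (invmx g) = 1.
Proof. by move=> h; rewrite det_inv h invr1. Qed.

Lemma invmxM1 (R : realType) (g h : 'M[R[i]]_2) : \det g = 1 -> \det h = 1 ->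
  invmx (g *m h) = invmx h *m invmx g.
Proof.
move=> dg dh; have ug := unit_det1 dg; have uh := unit_det1 dh.
have u : g *m h \in unitmx by rewrite unitmx_mul ug.
apply: (can_inj (mulKmx u)).
by rewrite mulmxV // mulmxA -(mulmxA g) mulmxV // mulmx1 mulmxV.
Qed.

Lemma invmx_conj (R : realType) (A B : 'M[R[i]]_2) : \det A = 1 -> \det B = 1 ->
  invmx (A *m B *m invmx A) = A *m invmx B *m invmx A.
Proof.
move=> dA dB; have dAB : \det (A *m B) = 1 by rewrite det_mulmx dA dB mulr1.
by rewrite (invmxM1 dAB (det_invmx1 dA)) invmxK (invmxM1 dA dB) mulmxA.
Qed.

Lemma invmxN2 (R : realType) (g : 'M[R[i]]_2) : \det g = 1 -> invmx (- g) = - invmx g.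
Proof.
move=> dg; have ug := unit_det1 dg.
have u : - g \in unitmx by rewrite unit_det1 // detN2.
by apply: (can_inj (mulKmx u)); rewrite mulmxV // mulNmx mulmxN opprK mulmxV.
Qed.

Lemma hval_act (R : realType) (g M : 'M[R[i]]_2) x :
  hval (act g M) x = hval M (invmx g *m x).
Proof. exact: hval_congr. Qed.

Lemma herm_act (R : realType) (g M : 'M[R[i]]_2) : herm M -> herm (act g M).
Proof. exact: herm_congr. Qed.

Lemma actN (R : realType) (g M : 'M[R[i]]_2) : act g (- M) = - act g M.
Proof. by rewrite /act mulmxN mulNmx. Qed.

Lemma Nact (R : realType) (g M : 'M[R[i]]_2) : \det g = 1 -> act (- g) M = act g M.
Proof. by move=> dg; rewrite /act invmxN2 // ctrN mulNmx mulmxN mulNmx opprK. Qed.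

Lemma act1 (R : realType) (M : 'M[R[i]]_2) : act 1%:M M = M.
Proof.
by rewrite /act invmx1 mulmx1 /ctr map_mx1 trmx1; exact: mul1mx.
Qed.

Lemma actM (R : realType) (g h M : 'M[R[i]]_2) : \det g = 1 -> \det h = 1 ->
  act (g *m h) M = act g (act h M).
Proof. by move=> dg dh; rewrite /act invmxM1 // ctrM !mulmxA. Qed.

Lemma det_act (R : realType) (g M : 'M[R[i]]_2) : \det g = 1 ->
  \det (act g M) = \det M.
Proof.
by move=> dg; rewrite /act !det_mulmx det_ctr det_invmx1 // conjc1 mul1r mulr1.
Qed.

(** The determinant -1 makes the form indefinite and fixes the scaling factor up to sign;
    the sign tells the two sides of the circle apart. *)
Definition disc (R : realType) (M : 'M[R[i]]_2) := herm M /\ \det M = -1.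

Lemma discN (R : realType) (M : 'M[R[i]]_2) : disc M -> disc (- M).
Proof. by case=> h d; split; [exact: hermN | rewrite detN2]. Qed.

Lemma disc_act (R : realType) (g M : 'M[R[i]]_2) : \det g = 1 -> disc M -> disc (act g M).
Proof. by move=> dg [h d]; split; [exact: herm_act | rewrite det_act]. Qed.

Lemma discE (R : realType) (M : 'M[R[i]]_2) : disc M ->
  exists (a d p q : R), M = mx22 a%:C (p +i* q) (p -i* q) d%:C /\
    p ^+ 2 + q ^+ 2 = 1 + a * d.
Proof.
case=> /hermE[a [d [[p q] ->]]]; rewrite det22 !mx22E => dM.
exists a, d, p, q; split => //.
by move: (congr1 (@complex.Re R) dM) => /=; rewrite !expr2; lra.
Qed.

(** The witness is the centre of the disc when [a > 0], a coordinate vector when a diagonal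
    entry is negative, and a point far along the normal when the disc is a half-plane. *)
Lemma disc_inhabited (R : realType) (M : 'M[R[i]]_2) : disc M -> exists x, hval M x < 0.
Proof.
move=> /discE[a [d [p [q [-> E]]]]].
have F t : hval (mx22 a%:C (p +i* q) (p -i* q) d%:C) (cvec (- t%:C * (p +i* q)) 1) =
   a * t ^+ 2 * (1 + a * d) - 2 * t * (1 + a * d) + d.
  by rewrite (hvalE a d (p +i* q)) -E /=; ring.
have [a0|a0] := ltP a 0.
  by exists (cvec 1 0); rewrite (hvalE a d (p +i* q)) /=; lra.
have [d0|d0] := ltP d 0.
  by exists (cvec 0 1); rewrite (hvalE a d (p +i* q)) /=; lra.
have [a1|a1] := ltP 0 a.
  exists (cvec (- (a^-1)%:C * (p +i* q)) 1); rewrite F.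
  have -> : a * a^-1 ^+ 2 * (1 + a * d) - 2 * a^-1 * (1 + a * d) + d = - a^-1.
    by field; rewrite gt_eqF.
  by rewrite oppr_lt0 invr_gt0.
exists (cvec (- (d + 1)%:C * (p +i* q)) 1); rewrite F.
have -> : a = 0 by lra.
by lra.
Qed.

Lemma hval_shift (R : realType) (M : 'M[R[i]]_2) x y : herm M -> exists B, forall e : R,
  hval M (x + e%:C *: y) = hval M x + B * e + hval M y * e ^+ 2.
Proof.
move=> /hermE[a [d [b ->]]]; rewrite (cvec_eta x) (cvec_eta y).
move: (x 0 0) (x 1 0) (y 0 0) (y 1 0) => x0 x1 y0 y1.
exists (2 * a * complex.Re (x0 * y0^*) + 2 * complex.Re (x0^* * b * y1) +
   2 * complex.Re (y0^* * b * x1) + 2 * d * complex.Re (x1 * y1^*)) => e.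
have -> : cvec x0 x1 + e%:C *: cvec y0 y1 = cvec (x0 + e%:C * y0) (x1 + e%:C * y1).
  by apply/matrixP => i j; rewrite !mxE; case: ifP.
rewrite !hvalE; case: x0 => ? ?; case: x1 => ? ?; case: y0 => ? ?; case: y1 => ? ?.
by case: b => ? ? /=; ring.
Qed.

(** The discs of [M] and [N] are disjoint.  Closed discs appear in the hypothesis so that
    tangent discs are allowed and the relation composes with [nested]. *)
Definition away (R : realType) (M N : 'M[R[i]]_2) :=
  forall x, hval M x <= 0 -> 0 <= hval N x.

(** A point of the closed disc is moved into the open disc along [x + e y] with [y] in the
    disc and [e] of the right sign; letting [e] tend to 0 closes the inequality. *)
Lemma away_closed (R : realType) (M N : 'M[R[i]]_2) : disc M -> disc N ->
  (forall x, hval M x < 0 -> 0 <= hval N x) -> away M N.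
Proof.
move=> dM dN h x x0; have [y y0] := disc_inhabited dM.
have [BM EM] := hval_shift x y dM.1; have [BN EN] := hval_shift x y dN.1.
have hs s : s = 1 \/ s = -1 -> s * BM <= 0 -> 0 <= hval N x.
  move=> s1 sB; apply: (@quadratic_ge0_at0 _ _ (s * BN) (hval N y)) => e e0 _.
  have es : (s * e) ^+ 2 = e ^+ 2 by case: s1 => ->; ring.
  have -> : hval N x + s * BN * e + hval N y * e ^+ 2 = hval N (x + (s * e)%:C *: y).
    by rewrite EN es; ring.
  apply: h; rewrite EM es; have : 0 < e ^+ 2 by rewrite exprn_gt0.
  by move=> e2; nra.
have [B0|B0] := leP BM 0; first by apply: (hs 1); [left|lra].
by apply: (hs (-1)); [right|lra].
Qed.

Lemma away_sym (R : realType) (M N : 'M[R[i]]_2) : disc M -> disc N ->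
  away M N -> away N M.
Proof.
move=> dM dN h; apply: away_closed => // x x0; rewrite leNgt; apply/negP => /ltW/h.
by rewrite leNgt x0.
Qed.

(** * The product of two disjoint discs *)

(** The Lorentz product attached to the quadratic form [- det] on Hermitian matrices; for
    two discs of radii r, r' at distance d it is (r^2 + r'^2 - d^2) / (2 r r'). *)
Definition ip (R : realType) (M N : 'M[R[i]]_2) : R :=
  complex.Re (M 0 1 * N 1 0 + M 1 0 * N 0 1 - M 0 0 * N 1 1 - M 1 1 * N 0 0) / 2.

Lemma det_ip (R : realType) (M N : 'M[R[i]]_2) : disc M -> disc N ->
  complex.Re (\det (M + N)) = - 2 - 2 * ip M N.
Proof.
move=> [_ dM] [_ dN]; have := congr1 (@complex.Re R) dM; have := congr1 (@complex.Re R) dN.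
rewrite /ip !det22 !(mxE _ _ 0 0, mxE _ _ 0 1, mxE _ _ 1 0, mxE _ _ 1 1).
rewrite /= !raddfB /= !raddfD /=.
move: (M 0 0) (M 0 1) (M 1 0) (M 1 1) (N 0 0) (N 0 1) (N 1 0) (N 1 1).
do 8 case=> ? ?; move=> /=; lra.
Qed.

Lemma conjcM (R : realType) (x y : R[i]) : conjc (x * y) = conjc x * conjc y.
Proof. exact: rmorphM. Qed.

Lemma conjcN (R : realType) (x : R[i]) : conjc (- x) = - conjc x.
Proof. exact: rmorphN. Qed.

Lemma polar (R : realType) (z : R[i]) :
  exists (r : R) (u : R[i]), [/\ 0 <= r, u * u^* = 1 & z = r%:C * u].
Proof.
have [->|z0] := eqVneq z 0; first by (exists 0, 1; split;
  rewrite ?mul0r ?rmorph1 ?mulr1 ?conjc1 ?mul0r).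
have nz : `|z| != 0 by rewrite normr_eq0.
exists (complex.Re `|z|), (z / `|z|); have e : (complex.Re `|z|)%:C = `|z|.
  by apply: RRe_real; exact: normr_real.
split.
- by have := normr_ge0 z; rewrite -e ler0c.
- have ec : `|z|^* = `|z| by rewrite -e conjc_real.
  rewrite conjcM conjc_inv ec.
  by rewrite mulrACA -sqr_normc -invfM -expr2 divff // expf_neq0.
- by rewrite e mulrC divfK.
Qed.

(** Gram-Schmidt: the second column of [P] is a negative vector and the first one its
    orthogonal vector.  This normal form is the unit disc. *)
Lemma diagonalize (R : realType) (M : 'M[R[i]]_2) : disc M ->
  exists (m : R) (P : 'M[R[i]]_2), [/\ 0 < m, \det P * (\det P)^* = (m ^+ 2)%:C &
    ctr P *m M *m P = mx22 m%:C 0 0 (- m%:C)].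
Proof.
move=> dM; have [v v0] := disc_inhabited dM; move: v0; rewrite (cvec_eta v).
move: (v 0 0) (v 1 0) => x y.
have [a [d [p [q [-> E]]]]] := discE dM.
rewrite (hvalE a d (p +i* q)); set m := _ + _ => m0.
pose r := x^* * a%:C + y^* * (p -i* q); pose s := x^* * (p +i* q) + y^* * d%:C.
exists (- m), (mx22 (- s) x r y); split; first by rewrite oppr_gt0.
- rewrite det22 !mx22E.
  have -> : - s * y - x * r = - m%:C.
    rewrite /s /r /m; case: x @r @s @m {m0} => x1 x2 /=; case: y => y1 y2 /=.
    by apply/eqP; rewrite eq_complex /=; apply/andP; split; apply/eqP; ring.
  by rewrite conjcN conjc_real mulrNN sqrrN -rmorphM expr2.
- have -> : ctr (mx22 (- s) x r y) = mx22 (- s^*) r^* x^* y^*.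
    by apply: matrix2P; rewrite !mxE //= conjcN.
  rewrite !mulmx22; rewrite /s /r /m.
  case: x @r @s @m {m0} => x1 x2 /=; case: y => y1 y2 /=.
  have E' : q ^+ 2 = 1 + a * d - p ^+ 2 by lra.
  apply: matrix2P; rewrite !mx22E; apply/eqP; rewrite eq_complex /=; apply/andP; split; apply/eqP.
  all: try by ring.
  all: try by ring: E'.
Qed.

(** Since [det (M + N) = - 2 - 2 ip M N], the claim is [0 <= det (M + N)], and a congruence
    multiplies this determinant by a positive number.  With [M] moved to the unit disc, the
    form of [N] is nonnegative on the unit disc, and testing it along the worst direction
    ([- u] below) gives the inequality. *)
Lemma disjoint_ip (R : realType) (M N : 'M[R[i]]_2) : disc M -> disc N ->
  away M N -> ip M N <= -1.
Proof.
move=> dM dN h.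
suff : 0 <= complex.Re (\det (M + N)) by rewrite det_ip //; lra.
have [m [P [m0 detP EP]]] := diagonalize dM.
have hN : herm (ctr P *m N *m P) by apply: herm_congr; case: dN.
have [al [de [b EN]]] := hermE hN.
have H x : hval (mx22 m%:C 0 0^* (- m)%:C) x < 0 -> 0 <= hval (mx22 al%:C b b^* de%:C) x.
  rewrite -EN -[0^*]/(0 -i* 0) oppr0 -[(- m)%:C]/((-m) +i* 0).
  have -> : (-m) +i* 0 = - m%:C by apply/eqP; rewrite eq_complex /= oppr0 !eqxx.
  by rewrite -EP !hval_congr => x0; apply: h; exact: ltW.
have m2 : 0 < m ^+ 2 by rewrite exprn_gt0.
have D : complex.Re (\det (ctr P *m (M + N) *m P)) = m ^+ 2 * complex.Re (\det (M + N)).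
  rewrite !det_mulmx det_ctr mulrAC [_^* * _]mulrC detP.
  by case: (\det (M + N)) => ? ? /=; ring.
have D' : \det (ctr P *m N *m P) = - (m ^+ 2)%:C.
  by rewrite !det_mulmx det_ctr mulrAC [_^* * _]mulrC detP dN.2 mulrN1.
have [r [u [r0 u1 Eb]]] := polar b.
have u1' : complex.Re (u * u^*) = 1 by rewrite u1.
move: u1 u1' Eb; case: u => u1 u2 _ u1' Eb.
have D2 : al * de - r ^+ 2 = - m ^+ 2.
  move: (congr1 (@complex.Re R) D'); rewrite EN det_herm Eb.
  have -> : complex.Re (r%:C * (u1 +i* u2) * (r%:C * (u1 +i* u2))^*) =
    r ^+ 2 * complex.Re ((u1 +i* u2) * (u1 +i* u2)^*) by rewrite /=; ring.
  by rewrite u1' mulr1 /=.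
have H1 s : 0 <= s -> s < 1 -> 0 <= al * s ^+ 2 - 2 * r * s + de.
  move=> s0 s1; have := H (cvec (- s%:C * (u1 +i* u2)) 1); rewrite !hvalE Eb.
  have u3 : u1 ^+ 2 + u2 ^+ 2 = 1 by rewrite -u1' /=; ring.
  have -> : m * complex.Re (- s%:C * (u1 +i* u2) * (- s%:C * (u1 +i* u2))^*) +
    2 * complex.Re ((- s%:C * (u1 +i* u2))^* * 0 * 1) + - m * complex.Re (1 * 1^*) =
    m * (s ^+ 2 * (u1 ^+ 2 + u2 ^+ 2) - 1) by rewrite /=; ring.
  have -> : al * complex.Re (- s%:C * (u1 +i* u2) * (- s%:C * (u1 +i* u2))^*) +
    2 * complex.Re ((- s%:C * (u1 +i* u2))^* * (r%:C * (u1 +i* u2)) * 1) +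
    de * complex.Re (1 * 1^*) =
    (u1 ^+ 2 + u2 ^+ 2) * (al * s ^+ 2 - 2 * r * s) + de by rewrite /=; ring.
  rewrite u3 mulr1 mul1r; apply; rewrite pmulr_rlt0 // subr_lt0.
  by rewrite expr_lt1.
(* the limit s -> 1 of the previous inequality: the value on the unit circle *)
have H2 : 0 <= al - 2 * r + de.
  apply: (@quadratic_ge0_at0 _ _ (2 * r - 2 * al) al) => e e0 e1.
  have := H1 (1 - e); rewrite subr_ge0 ltrBlDr ltrDl => /(_ e1 e0); nra.
have H3 : 0 <= de by have := H1 0 (lexx _) ltr01; lra.
have D3 : complex.Re (\det (ctr P *m (M + N) *m P)) = m * (de - al) - 2 * m ^+ 2.
  rewrite mulmxDr mulmxDl EP EN det22 !(mxE _ _ 0 0, mxE _ _ 0 1, mxE _ _ 1 0, mxE _ _ 1 1) /=.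
  have -> : m * (de - al) - 2 * m ^+ 2 =
    m * (de - al) - 2 * m ^+ 2 + (al * de - r ^+ 2 + m ^+ 2) by rewrite D2; ring.
  have -> : r ^+ 2 = complex.Re (b * b^*).
    rewrite Eb -[LHS]mulr1 -u1' /=; ring.
  by case: (b) => b1 b2 /=; ring.
suff : 2 * m <= de - al.
  by move=> K; rewrite -(pmulr_rge0 _ m2) -D D3; nra.
rewrite leNgt; apply/negP => K.
(* the other sign in 4 m^2 <= (de - al)^2; it makes the form of N negative at r / al < 1 *)
have K1 : 2 * m <= al - de by nra.
have al0 : 0 < al by lra.
have ral : r < al by nra.
have := H1 (r / al); rewrite divr_ge0 ?(ltW al0) // ltr_pdivrMr // mul1r.
have -> : al * (r / al) ^+ 2 - 2 * r * (r / al) + de = (al * de - r ^+ 2) / al.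
  by field; rewrite gt_eqF.
move=> /(_ isT ral); rewrite D2 pmulr_lge0 ?invr_gt0 //; lra.
Qed.

(** * Ping-pong along reduced words *)

(** The disc of [M] lies in the disc of [N]: it is away from the complementary disc. *)
Definition nested (R : realType) (M N : 'M[R[i]]_2) := away M (- N).

Lemma nestedP (R : realType) (M N : 'M[R[i]]_2) :
  nested M N <-> forall x, hval M x <= 0 -> hval N x <= 0.
Proof.
by split=> h x /h; rewrite hvalN oppr_ge0.
Qed.

Lemma nested_refl (R : realType) (M : 'M[R[i]]_2) : nested M M.
Proof. exact/nestedP. Qed.

Lemma nested_trans (R : realType) (M N P : 'M[R[i]]_2) :
  nested M N -> nested N P -> nested M P.
Proof. by move=> /nestedP h1 /nestedP h2; apply/nestedP => x /h1 /h2. Qed.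

Lemma nested_away (R : realType) (M N P : 'M[R[i]]_2) :
  nested M N -> away N P -> away M P.
Proof. by move=> /nestedP h1 h2 x /h1 /h2. Qed.

Lemma away_act (R : realType) (g M N : 'M[R[i]]_2) :
  away M N -> away (act g M) (act g N).
Proof. by move=> h x; rewrite !hval_act; exact: h. Qed.

Lemma nested_act (R : realType) (g M N : 'M[R[i]]_2) :
  nested M N -> nested (act g M) (act g N).
Proof. by rewrite /nested -actN; exact: away_act. Qed.

Lemma actK (R : realType) (g M : 'M[R[i]]_2) : \det g = 1 ->
  act (invmx g) (act g M) = M.
Proof.
by move=> dg; rewrite -actM ?det_invmx1 // mulVmx ?unit_det1 // act1.
Qed.

Lemma ipC (R : realType) (M N : 'M[R[i]]_2) : ip M N = ip N M.
Proof. by rewrite /ip; congr (complex.Re _ / _); ring. Qed.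

Lemma ipNr (R : realType) (M N : 'M[R[i]]_2) : ip M (- N) = - ip M N.
Proof.
have ReN (z : R[i]) : - complex.Re z = complex.Re (- z) by case: z.
rewrite /ip !(mxE _ _ 0 0, mxE _ _ 0 1, mxE _ _ 1 0, mxE _ _ 1 1) -[RHS]mulNr ReN.
by congr (complex.Re _ / _); ring.
Qed.

Lemma nested_ip (R : realType) (M N : 'M[R[i]]_2) : disc M -> disc N ->
  nested M N -> 1 <= ip M N.
Proof.
by move=> dM dN /(disjoint_ip dM (discN dN)); rewrite ipNr lerNl opprK.
Qed.

(** The first component chooses the generator, the second one tells whether it is
    inverted. *)
Definition letter := (bool * bool)%type.
Definition linv (l : letter) : letter := (l.1, ~~ l.2).
Definition noncancel (x y : letter) := y != linv x.

Lemma linvK : involutive linv.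
Proof. by case=> a b; rewrite /linv /= negbK. Qed.

Definition ev (R : realType) (g : letter -> 'M[R[i]]_2) (w : seq letter) :=
  foldr (fun l A => g l *m A) 1%:M w.

(** [M l] is the disc into which [g l] maps the outside of the disc of the inverse letter:
    for [g1] mapping the inside of C1 onto the outside of C2, the letter of [g1] has the
    inside of C2, and the inverse letter the inside of C1. *)
Record pingpong (R : realType) (g M : letter -> 'M[R[i]]_2) : Prop := PingPong {
  pp_det : forall l, \det (g l) = 1;
  pp_inv : forall l, g (linv l) = invmx (g l);
  pp_disc : forall l, disc (M l);
  pp_act : forall l, act (g l) (M (linv l)) = - M l;
  pp_away : forall l l', l != l' -> away (M l) (M l') }.

Lemma ev_cat (R : realType) (g : letter -> 'M[R[i]]_2) u v :
  ev g (u ++ v) = ev g u *m ev g v.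
Proof. by elim: u => [|x u IH] /=; rewrite ?mul1mx // IH mulmxA. Qed.

Lemma ev_rcons (R : realType) (g : letter -> 'M[R[i]]_2) u x :
  ev g (rcons u x) = ev g u *m g x.
Proof. by rewrite -cats1 ev_cat /= mulmx1. Qed.

Lemma det_ev (R : realType) (g M : letter -> 'M[R[i]]_2) w : pingpong g M ->
  \det (ev g w) = 1.
Proof.
move=> pp; elim: w => [|x w IH] /=; first by rewrite det1.
by rewrite det_mulmx IH (pp_det pp) mulr1.
Qed.

Lemma reduce_word (R : realType) (g M : letter -> 'M[R[i]]_2) w : pingpong g M ->
  exists w', [/\ sorted noncancel w', (size w' <= size w)%N & ev g w = ev g w'].
Proof.
move=> pp; elim: w => [|x w [w' [sw ww' ew]]]; first by exists [::].
case: w' sw ww' ew => [|y w'] /= sw ww' ->; first by exists [:: x].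
have [yx|yx] := eqVneq y (linv x); last by exists [:: x, y & w']; split => //=;
  rewrite sw /noncancel yx.
exists w'; split; [exact: path_sorted sw|exact: leqW (ltnW ww')|].
by rewrite yx (pp_inv pp) mulmxA mulmxV ?mul1mx // unit_det1 ?(pp_det pp).
Qed.

Lemma third_letter (u v : letter) : exists t, (t != u) && (t != v).
Proof.
by case: u v => [[] []] [[] []]; (try by exists (true, true));
  (try by exists (true, false)); exists (false, true).
Qed.

(** If two of the four discs covered the sphere up to their boundaries, a third disc
    would lie in one of them and be disjoint from it. *)
Lemma not_nested_opp (R : realType) (g M : letter -> 'M[R[i]]_2) u v :
  pingpong g M -> ~ nested (- M v) (M u).
Proof.
move=> pp h; have [t /andP[tu tv]] := third_letter u v.
have h1 : nested (M t) (M u).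
  apply: nested_trans h; rewrite /nested opprK; exact: (pp_away pp).
have := nested_ip (pp_disc pp t) (pp_disc pp u) h1.
have := disjoint_ip (pp_disc pp t) (pp_disc pp u) (pp_away pp tu); lra.
Qed.

Lemma nested_step (R : realType) (g M : letter -> 'M[R[i]]_2) x y :
  pingpong g M -> noncancel x y -> nested (act (g x) (M y)) (M x).
Proof.
by move=> pp xy; rewrite /nested -(pp_act pp); apply/away_act/(pp_away pp).
Qed.

(** The nesting of [nested_step] is strict: equality would mean that the discs of [linv x]
    and of [y] together fill the sphere. *)
Lemma not_nested_in_step (R : realType) (g M : letter -> 'M[R[i]]_2) x y :
  pingpong g M -> ~ nested (M x) (act (g x) (M y)).
Proof.
move=> pp /(nested_act (g := invmx (g x))); rewrite actK ?(pp_det pp) // -(pp_inv pp).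
by rewrite -{2}(linvK x) (pp_act pp); exact: not_nested_opp pp.
Qed.

Lemma nested_chain (R : realType) (g M : letter -> 'M[R[i]]_2) x s :
  pingpong g M -> path noncancel x s ->
  nested (act (ev g (belast x s)) (M (last x s))) (M x).
Proof.
move=> pp; elim: s x => [|y s IH] x /=; first by rewrite act1 => _; exact: nested_refl.
case/andP => xy /IH h; rewrite (actM _ (pp_det pp x) (det_ev _ pp)).
exact: nested_trans (nested_act h) (nested_step pp xy).
Qed.

(** The two cases are whether [l] prolongs the reduced word or cancels its last letter; in
    the second case the translate is the complement of a translate by a shorter word. *)
Lemma translate_nested (R : realType) (g M : letter -> 'M[R[i]]_2) x s l :
  pingpong g M -> path noncancel x s ->
  (noncancel (last x s) l /\ nested (act (ev g (x :: s)) (M l)) (M x)) \/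
  (l = linv (last x s) /\ nested (- act (ev g (x :: s)) (M l)) (M x)).
Proof.
move=> pp ps; have [ll|ll] := eqVneq l (linv (last x s)).
  right; split => //; rewrite lastI ev_rcons (actM _ (det_ev _ pp) (pp_det pp _)).
  by rewrite ll (pp_act pp) actN opprK; exact: nested_chain.
left; split => //; have : path noncancel x (rcons s l) by rewrite rcons_path ps.
by move/(nested_chain pp); rewrite belast_rcons last_rcons.
Qed.

(** A translate of a disc, or its complement, lies in one of the four discs; with respect
    to that disc and to the three others it is nested or away. *)
Lemma noncrossing_word (R : realType) (g M : letter -> 'M[R[i]]_2) w l l' :
  pingpong g M -> 1 <= `|ip (act (ev g w) (M l)) (M l')|.
Proof.
move=> pp; have [w' [sw _ ->]] := reduce_word w pp.
have D := pp_disc pp.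
have key A x : disc A -> nested A (M x) -> 1 <= `|ip A (M l')|.
  move=> dA Ax; have [<-|xl] := eqVneq x l'.
    by apply: le_trans (ler_norm _); exact: nested_ip.
  rewrite -normrN; apply: le_trans (ler_norm _).
  by rewrite lerNr; apply: disjoint_ip => //; apply: nested_away Ax (pp_away pp xl).
have dw : disc (act (ev g w') (M l)) by apply: disc_act; rewrite ?(det_ev _ pp).
case: w' sw dw => [|x s] sw dw; first by rewrite act1; apply: (key _ l) => //; exact: nested_refl.
have [[_ h]|[_ h]] := translate_nested l pp sw; first exact: key h.
by have := key _ _ (discN dw) h; rewrite ipC ipNr normrN ipC.
Qed.

(** Distinct group elements give distinct translates, as oriented discs: the image of a disc
    under a nontrivial reduced word lies strictly inside one of the four discs, or is the
    complement of a disc contained in one of them. *)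
Lemma translate_eq_disc (R : realType) (g M : letter -> 'M[R[i]]_2) w l l' :
  pingpong g M -> act (ev g w) (M l) = M l' -> l = l' /\ ev g w = 1%:M.
Proof.
move=> pp; have [w' [sw _ ->]] := reduce_word w pp.
have D := pp_disc pp.
have near x y : nested (M x) (M y) -> x = y.
  move=> h; apply/eqP/negPn/negP => xy.
  by have := nested_ip (D x) (D y) h; have := disjoint_ip (D x) (D y) (pp_away pp xy); lra.
case: w' sw => [|x s] sw E.
  by split => //; apply: near; rewrite -E act1; exact: nested_refl.
exfalso; have [[nl h]|[_ h]] := translate_nested l pp sw; last first.
  by move: h; rewrite E; exact: not_nested_opp pp.
have xl' : l' = x by apply: near; rewrite -E.
have : path noncancel x (rcons s l) by rewrite rcons_path; apply/andP; split.
move: E; rewrite {}xl'.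
case: (s) => [|y s'] /= E.
  move=> _; have : nested (M x) (M x) by exact: nested_refl.
  by rewrite -{2}E mulmx1; exact: not_nested_in_step.
case/andP => xy /(nested_chain pp); rewrite belast_rcons last_rcons => /(nested_act (g := g x)).
by rewrite -(actM _ (pp_det pp x) (det_ev (y :: s') pp)) E; exact: not_nested_in_step.
Qed.

(** Conjugating by the first letter shortens a reduced word whose last letter cancels
    the first one. *)
Lemma cyclic_reduction (R : realType) (g M : letter -> 'M[R[i]]_2) w :
  pingpong g M -> ev g w = 1%:M \/
  exists u x s, path noncancel x (rcons s x) /\
    ev g w = ev g u *m ev g (x :: s) *m invmx (ev g u).
Proof.
move=> pp; have [n] := ubnP (size w); elim: n w => // n IH w wn.
have [w' [sw ww' ->]] := reduce_word w pp.
case: w' sw ww' => [|x s]; first by left.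
case/lastP: s => [|s y] sw ww'.
  right; exists [::], x, [::]; split; first by rewrite /= /noncancel; case: (x) => [] [] [].
  by rewrite /= mul1mx mulmx1 invmx1 mulmx1.
have [xy|xy] := eqVneq x (linv y); last first.
  right; exists [::], x, (rcons s y); split; last by rewrite /= mul1mx invmx1 mulmx1.
  by rewrite rcons_path last_rcons; apply/andP; split.
have gy : g y = invmx (g x) by rewrite xy (pp_inv pp) invmxK.
have ux : g x \in unitmx by rewrite unit_det1 ?(pp_det pp).
have -> : ev g (x :: rcons s y) = g x *m ev g s *m invmx (g x).
  by rewrite -rcons_cons ev_rcons gy.
have : (size s < n)%N.
  by move: ww'; rewrite /= size_rcons => ww'; apply: leq_trans (leqW _) _;
    last exact: leq_trans ww' _.
case/IH => [->|[u [x' [s' [p' ->]]]]]; first by left; rewrite mulmx1 mulmxV.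
right; exists (x :: u), x', s'; split => //.
by rewrite [ev g (x :: u)]/= invmxM1 ?(pp_det pp) ?(det_ev _ pp) // !mulmxA.
Qed.

(** * Axes of group elements and parallel lines *)

Lemma actD (R : realType) (g M N : 'M[R[i]]_2) : act g (M + N) = act g M + act g N.
Proof. by rewrite /act mulmxDr mulmxDl. Qed.

Lemma ip_act (R : realType) (g M N : 'M[R[i]]_2) : \det g = 1 -> disc M -> disc N ->
  ip (act g M) (act g N) = ip M N.
Proof.
move=> dg dM dN; have := det_ip (disc_act dg dM) (disc_act dg dN).
by rewrite -actD det_act // det_ip //; lra.
Qed.

(** Equality in PSL(2,C). *)
Definition pm (R : realType) (A B : 'M[R[i]]_2) := A = B \/ A = - B.

Lemma pm_sym (R : realType) (A B : 'M[R[i]]_2) : pm A B -> pm B A.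
Proof. by case=> ->; [left|right; rewrite opprK]. Qed.

Lemma pm_trans (R : realType) (A B C : 'M[R[i]]_2) : pm A B -> pm B C -> pm A C.
Proof.
by case=> -> [] ->; [left|right|right|left]; rewrite ?opprK.
Qed.

Lemma pmM (R : realType) (A B C D : 'M[R[i]]_2) : pm A B -> pm C D -> pm (A *m C) (B *m D).
Proof.
by case=> -> [] ->; [left|right|right|left]; rewrite ?mulmxN ?mulNmx ?opprK.
Qed.

Lemma pm_act (R : realType) (A B M : 'M[R[i]]_2) : \det B = 1 -> pm A B -> act A M = act B M.
Proof. by move=> dB [] -> //; exact: Nact. Qed.

Definition translate (R : realType) (g M : letter -> 'M[R[i]]_2) P :=
  exists w l, P = act (ev g w) (M l).

Definition words (R : realType) (g : letter -> 'M[R[i]]_2) A := exists w, pm A (ev g w).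

Lemma translate_disc (R : realType) (g M : letter -> 'M[R[i]]_2) P :
  pingpong g M -> translate g M P -> disc P.
Proof.
by move=> pp [w [l ->]]; apply: disc_act; [exact: det_ev pp|exact: (pp_disc pp)].
Qed.

Lemma translate_act (R : realType) (g M : letter -> 'M[R[i]]_2) A P :
  pingpong g M -> words g A -> translate g M P -> translate g M (act A P).
Proof.
move=> pp [v Av] [w [l ->]]; exists (v ++ w), l.
by rewrite (pm_act _ (det_ev _ pp) Av) ev_cat (actM _ (det_ev _ pp) (det_ev _ pp)).
Qed.

Lemma inv_ev (R : realType) (g M : letter -> 'M[R[i]]_2) w : pingpong g M ->
  exists w', invmx (ev g w) = ev g w'.
Proof.
move=> pp; elim: w => [|x w [w' E]] /=; first by exists [::]; rewrite invmx1.
exists (rcons w' (linv x)).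
by rewrite ev_rcons (pp_inv pp) invmxM1 ?(pp_det pp) ?(det_ev _ pp) // E.
Qed.

Lemma noncrossing (R : realType) (g M : letter -> 'M[R[i]]_2) P Q :
  pingpong g M -> translate g M P -> translate g M Q -> 1 <= `|ip P Q|.
Proof.
move=> pp tP [v [l' ->]]; have dP := translate_disc pp tP; case: tP dP => u [l ->] dP.
have dv := det_ev v pp; have dv' := det_invmx1 dv.
have dQ : disc (act (ev g v) (M l')) by apply: disc_act => //; exact: (pp_disc pp).
rewrite -(ip_act dv' dP dQ) actK // -(actM _ dv' (det_ev _ pp)).
by have [w ->] := inv_ev v pp; rewrite -ev_cat; exact: noncrossing_word.
Qed.

(** The axis of a nontrivial element in the tree of translated circles: [P0] and [P2] are
    consecutive images of one disc under the element, and [P1] is the first disc met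
    between them.  It is different from [P2] unless the element is conjugate to a single
    letter. *)
Lemma axis_discs (R : realType) (g M : letter -> 'M[R[i]]_2) w :
  pingpong g M -> ev g w <> 1%:M ->
  exists u x P1,
    let P0 := act (ev g u) (M x) in let P2 := act (ev g w) P0 in
    [/\ translate g M P1, nested P2 P1, nested P1 P0, ~ nested P0 P1 &
      ~ nested P1 P2 \/ ev g w = ev g u *m g x *m invmx (ev g u)].
Proof.
move=> pp w1; case: (cyclic_reduction w pp) => // -[u [x [s [ps Ew]]]].
have du := det_ev u pp; have uu := unit_det1 du.
have P2E : act (ev g w) (act (ev g u) (M x)) = act (ev g u) (act (ev g (x :: s)) (M x)).
  by rewrite -(actM _ (det_ev w pp) du) -(actM _ du (det_ev (x :: s) pp)) Ew mulmxKV.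
pose y := head x s.
have xy : noncancel x y by move: ps; rewrite /y; case: (s) => [|z t] /= /andP[].
have unact P Q : nested (act (ev g u) P) (act (ev g u) Q) -> nested P Q.
  by move/(nested_act (g := invmx (ev g u))); rewrite !actK.
have nestg : nested (act (ev g (x :: s)) (M x)) (act (g x) (M y)).
  move: ps; rewrite /y; case: (s) => [|z t] /=; first by rewrite mulmx1 => _; exact: nested_refl.
  case/andP => _ /(nested_chain pp); rewrite belast_rcons last_rcons.
  by rewrite (actM _ (pp_det pp x) (det_ev (z :: t) pp)); exact: nested_act.
exists u, x, (act (ev g u) (act (g x) (M y))); split.
- exists (rcons u x), y; rewrite ev_rcons; apply/esym/actM => //; exact: (pp_det pp).
- by rewrite P2E; exact: nested_act.
- by apply/nested_act/nested_step.
- by move=> /unact; exact: not_nested_in_step.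
- move: ps Ew P2E; rewrite /y; case: (s) => [|z t] ps Ew P2E; first by right; rewrite Ew /= mulmx1.
  left; rewrite P2E => /unact.
  rewrite (actM _ (pp_det pp x) (det_ev (z :: t) pp)) => /(nested_act (g := invmx (g x))).
  rewrite !actK ?(pp_det pp) //.
  move: ps => /= /andP[_]; case: (t) => [|z' t'].
    by move=> _; rewrite /= mulmx1; exact: not_nested_in_step.
  rewrite /= => /andP[zz' /(nested_chain pp)].
  rewrite belast_rcons last_rcons => /(nested_act (g := g z)).
  rewrite -(actM _ (pp_det pp z) (det_ev (z' :: t') pp)) => h1 h2.
  exact: not_nested_in_step pp (nested_trans h2 h1).
Qed.

(** What is common to [T], which fixes infinity, and [S], which fixes 0.  The entry [i i]
    of a disc vanishes when its boundary passes through the fixed point; the disc is then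
    described by the unit complex number [P 0 1] and by the real number [P j j], which the
    [k]-th power shifts by [k] times [tau (P 0 1)]. *)
Record parabolic (R : realType) (A : int -> 'M[R[i]]_2) (i j : 'I_2) (tau : R[i] -> R) :=
 Parabolic {
  pa_ij : (i == 0) && (j == 1) || (i == 1) && (j == 0);
  pa_det : forall k, \det (A k) = 1;
  pa_comm : forall k, A k *m A 1 = A 1 *m A k;
  pa_neq1 : ~ pm (A 1) 1%:M;
  pa_fix : forall P, disc P -> 1 <= ip (act (A 1) P) P -> P i i = 0;
  pa_shift : forall k P, disc P -> P i i = 0 ->
    [/\ act (A k) P i i = 0, act (A k) P 0 1 = P 0 1 &
      complex.Re (act (A k) P j j) = complex.Re (P j j) + k%:~R * tau (P 0 1)] }.

(** Nested half-planes have the same normal, and their offsets are ordered.  This covers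
    discs tangent at 0 as well, by exchanging the two coordinates. *)
Lemma nested_lines (R : realType) (i j : 'I_2) (P Q : 'M[R[i]]_2) :
  (i == 0) && (j == 1) || (i == 1) && (j == 0) ->
  disc P -> disc Q -> P i i = 0 -> Q i i = 0 -> nested P Q ->
  P 0 1 = Q 0 1 /\ complex.Re (Q j j) <= complex.Re (P j j).
Proof.
move=> ij dP dQ; have := nested_ip dP dQ.
have [a [d [p [q [-> E]]]]] := discE dP.
have [a' [d' [p' [q' [-> E']]]]] := discE dQ.
case/orP: ij => /andP[/eqP-> /eqP->]; rewrite !mx22E =>
  + /(congr1 (@complex.Re R)) /= a0 /(congr1 (@complex.Re R)) /= a1 h => /(_ h);
  rewrite /ip !mx22E /= => h1.
all: have E1 : p ^+ 2 + q ^+ 2 = 1 by rewrite E a0; ring.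
all: have E2 : p' ^+ 2 + q' ^+ 2 = 1 by rewrite E' a1; ring.
all: have h2 : 1 <= p * p' + q * q' by move: h1; rewrite a0 a1; lra.
all: have s0 : (p - p') ^+ 2 + (q - q') ^+ 2 <= 0 by rewrite !sqrrB; lra.
all: have p0 := sqr_ge0 (p - p'); have q0 := sqr_ge0 (q - q').
all: have /eqP : (p - p') ^+ 2 = 0 by lra.
all: have /eqP : (q - q') ^+ 2 = 0 by lra.
all: rewrite !sqrf_eq0 !subr_eq0 => /eqP qq' /eqP pp'.
all: rewrite pp' qq'; split => //.
- move/nestedP: h => /(_ (cvec (- (d / 2)%:C * (p' +i* q')) 1)).
  rewrite (hvalE a d (p +i* q)) (hvalE a' d' (p' +i* q')) pp' qq' a0 a1 /=.
  have K : d * p' * p' + d * q' * q' = d by rewrite -[RHS]mulr1 -E2; ring.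
  by move=> H; have := H ltac:(lra); lra.
- move/nestedP: h => /(_ (cvec 1 (- (a / 2)%:C * (p' -i* q')))).
  rewrite (hvalE a d (p +i* q)) (hvalE a' d' (p' +i* q')) pp' qq' a0 a1 /=.
  have K : a * p' * p' + a * q' * q' = a by rewrite -[RHS]mulr1 -E2; ring.
  by move=> H; have := H ltac:(lra); lra.
Qed.

Lemma nested_linesV (R : realType) (i j : 'I_2) (P Q : 'M[R[i]]_2) :
  (i == 0) && (j == 1) || (i == 1) && (j == 0) ->
  disc P -> disc Q -> P i i = 0 -> Q i i = 0 ->
  P 0 1 = Q 0 1 -> complex.Re (Q j j) <= complex.Re (P j j) -> nested P Q.
Proof.
move=> ij dP dQ.
have [a [d [p [q [-> E]]]]] := discE dP.
have [a' [d' [p' [q' [-> E']]]]] := discE dQ.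
case/orP: ij => /andP[/eqP-> /eqP->]; rewrite !mx22E
  => /(congr1 (@complex.Re R)) /= a0 /(congr1 (@complex.Re R)) /= a1 [-> ->] dd.
all: apply/nestedP => x; rewrite (cvec_eta x) (hvalE a d (p' +i* q')) (hvalE a' d' (p' +i* q')).
all: rewrite a0 a1; case: (x 0 0) => x1 x2; case: (x 1 0) => y1 y2 /=.
all: have := sqr_ge0 x1; have := sqr_ge0 x2; have := sqr_ge0 y1; have := sqr_ge0 y2;
  rewrite !expr2; nra.
Qed.

(** * Two arithmetic progressions *)

Lemma no_int_between (R : realType) (k : int) (t : R) :
  0 < t -> k%:~R * t < 1 * t -> 0 < k%:~R * t -> False.
Proof. by move=> t0; rewrite ltr_pM2r // pmulr_lgt0 // ltr0z ltrz1; lia. Qed.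

(** Consecutive translates [P0], [P1], [P2] along the axis of a parabolic element all have
    their boundary through the fixed point, hence have offsets r0 < r1 <= r0 + t where [t] is
    the shift.  If [r1 < r0 + t], the offsets of the orbits of [P0] and [P1] cannot both meet
    0, since both would then be integral multiples of [t].  Otherwise the element is
    conjugate to a letter, and if the orbit of [P0] meets 0 one of its members has offset 0. *)
Lemma parabolic_axis (R : realType) (g M : letter -> 'M[R[i]]_2)
    (A : int -> 'M[R[i]]_2) (i j : 'I_2) (tau : R[i] -> R) :
  pingpong g M -> parabolic A i j tau -> (forall k, words g (A k)) ->
  exists P, [/\ translate g M P, P i i = 0, tau (P 0 1) != 0 &
    (forall k : int, complex.Re (P j j) + k%:~R * tau (P 0 1) != 0) \/
    (complex.Re (P j j) = 0 /\ exists u x, P = act (ev g u) (M x) /\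
       pm (A 1) (ev g u *m g x *m invmx (ev g u)))].
Proof.
move=> pp pa wA; have [w Aw] := wA 1.
have dw := det_ev w pp.
have w1 : ev g w <> 1%:M by move=> e; apply: (pa_neq1 pa); rewrite -e.
have [u [x [P1 []]]] := axis_discs pp w1; rewrite -(pm_act _ dw Aw).
have tP0 : translate g M (act (ev g u) (M x)) by exists u, x.
have [P0 P0E] : exists P0, P0 = act (ev g u) (M x) by eexists.
rewrite -P0E in tP0 *.
have tP2 : translate g M (act (A 1) P0) by exact: translate_act.
have [P2 P2E] : exists P2, P2 = act (A 1) P0 by eexists.
rewrite -P2E in tP2 * => tP1 n21 n10 nn01 last.
have [d0 d1 d2] := And3 (translate_disc pp tP0) (translate_disc pp tP1) (translate_disc pp tP2).
have P00 : P0 i i = 0.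
  by apply: (pa_fix pa d0); rewrite -P2E; apply: nested_ip d2 d0 _; exact: nested_trans n21 n10.
have [P20 E2 D2] := pa_shift pa 1 d0 P00; rewrite -P2E in P20 E2 D2.
have ij := pa_ij pa.
(* P1 lies between P0 and P2, so its image is nested in it as well *)
have P10 : P1 i i = 0.
  apply: (pa_fix pa d1); apply: nested_ip (disc_act _ d1) d1 _; first exact: pa_det pa _.
  by apply: nested_trans n21; rewrite P2E; exact: nested_act.
have [E10 le10] := nested_lines ij d1 d0 P10 P00 n10.
have [E21 le21] := nested_lines ij d2 d1 P20 P10 n21.
have lt10 : complex.Re (P0 j j) < complex.Re (P1 j j).
  by rewrite ltNge; apply/negP => h; apply: nn01;
    exact: nested_linesV ij d0 d1 P00 P10 (esym E10) h.
have lt21 : ~ nested P1 P2 -> complex.Re (P1 j j) < complex.Re (P2 j j).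
  move=> nn12; rewrite ltNge; apply/negP => h; apply: nn12.
  exact: nested_linesV ij d1 d2 P10 P20 (esym E21) h.
have D0 k := pa_shift pa k d0 P00.
rewrite mul1r in D2; set t := tau (P0 0 1) in D2 D0 *.
(* the offsets are made opaque so that arithmetic does not unfold the matrices *)
have [r0 r0E] : exists r, r = complex.Re (P0 j j) by eexists.
have [r1 r1E] : exists r, r = complex.Re (P1 j j) by eexists.
have [r2 r2E] : exists r, r = complex.Re (P2 j j) by eexists.
rewrite -?r0E -?r1E -?r2E in le10 le21 lt10 lt21 D0 D2.
have t0 : 0 < t by move: lt10 le21 D2; clear; lra.
have tn0 : t != 0 by rewrite gt_eqF.
have [av0|/existsNP[k0 /negP/negPn/eqP k0E]] := pselect (forall k : int, r0 + k%:~R * t != 0).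
  by exists P0; split; [exact: tP0|exact: P00|exact: tn0|left; rewrite -r0E].
case: last => [/lt21 {}lt21|Ew].
  exists P1; rewrite E10 -/t -r1E; split; [exact: tP1|exact: P10|exact: tn0|left => k].
  apply/negP => /eqP kE.
  have e : r1 - r0 = (k0 - k)%:~R * t.
    by rewrite rmorphB /= mulrBl; move: k0E kE; clear; lra.
  have : 0 < (k0 - k)%:~R * t by move: e lt10; clear; lra.
  have : (k0 - k)%:~R * t < 1 * t by move: e lt21 D2; clear; lra.
  by move: t0; clear; exact: no_int_between.
have [dk Ak0] := (pa_det pa k0, wA k0).
have [Q0 E0 D0'] := D0 k0.
exists (act (A k0) P0); rewrite E0 D0' -/t; split;
  [exact: translate_act|exact: Q0|exact: tn0|right; split; first by []].
case: Ak0 => v Av; exists (v ++ u), x; split.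
  by rewrite P0E (pm_act _ (det_ev _ pp) Av) ev_cat (actM _ (det_ev _ pp) (det_ev _ pp)).
have dv := det_ev v pp; have du := det_ev u pp; have uu := unit_det1 du; have uv := unit_det1 dv.
rewrite ev_cat (invmxM1 dv du) !mulmxA.
have -> : ev g v *m ev g u *m g x *m invmx (ev g u) *m invmx (ev g v) =
  ev g v *m ev g w *m invmx (ev g v) by rewrite Ew !mulmxA.
have -> : A 1 = A k0 *m A 1 *m invmx (A k0).
  by rewrite (pa_comm pa) -mulmxA (mulmxV (unit_det1 dk)) mulmx1.
apply: pmM; first exact: pmM.
by case: Av => ->; [left|right; exact: invmxN2].
Qed.

(** With [-p <= 0 < q] and [-r < 0 < s] consecutive terms, the hypotheses read
    [p r, q s >= 2 + 2 c] and [p s, q r >= 2 - 2 c] when [p > 0], and the sum of the four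
    bounds is 8.  When [p = 0] the first hypothesis forces [|c| = 1], and the terms [q] and
    [-q] give the same total. *)
Lemma progressions_at_zero (R : realType) (c p q r s : R) :
  0 <= p -> 0 < q -> 0 < r -> 0 < s -> `|c| <= 1 ->
  2 <= `|2 * c - (- p) * (- r)| -> 2 <= `|2 * c - q * s| ->
  2 <= `|2 * c - (- p) * s| -> 2 <= `|2 * c - q * (- r)| ->
  (p = 0 -> 2 <= `|2 * c - (- q) * (- r)| /\ 2 <= `|2 * c - (- q) * s|) ->
  8 <= (p + q) * (r + s).
Proof.
move=> p0 q0 r0 s0; rewrite ler_norml => /andP[c1 c2].
have pos (a b : R) : 0 < a -> 0 < b -> 2 <= `|2 * c - a * b| -> 2 + 2 * c <= a * b.
  by move=> a0 b0; have := mulr_gt0 a0 b0; rewrite ler_normr => ab /orP[]; lra.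
have neg (a b : R) : 0 < a -> 0 < b -> 2 <= `|2 * c + a * b| -> 2 - 2 * c <= a * b.
  by move=> a0 b0; have := mulr_gt0 a0 b0; rewrite ler_normr => ab /orP[]; lra.
have -> : (p + q) * (r + s) = p * r + p * s + q * r + q * s by ring.
move: p0; rewrite le_eqVlt => /orP[/eqP p0|p0].
  rewrite -p0 !mulNr !mulrN !mul0r !opprK subr0 !ler_normr => h1 h2 h3 h4 /(_ erefl)[h5 h6].
  have : c = 1 \/ c = -1 by move: h1 => /orP[]; [left|right]; lra.
  case=> cE.
    by have := pos _ _ q0 r0; have := pos _ _ q0 s0; rewrite !ler_normr => /(_ h2) ? /(_ h5) ?; lra.
  by have := neg _ _ q0 r0; have := neg _ _ q0 s0; rewrite !ler_normr => /(_ h6) ? /(_ h4) ?; lra.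
rewrite !mulNr !mulrN !opprK => /pos h1 /pos h2 /neg h3 /neg h4 _.
by have := h1 p0 r0; have := h2 q0 s0; have := h3 p0 s0; have := h4 q0 r0; lra.
Qed.

(** The sign [e] accounts for decreasing progressions. *)
Lemma bracket (R : realType) (x s : R) : s != 0 -> exists k : int, exists e : int,
  [/\ e%:~R * s = `|s|, x + k%:~R * s <= 0 & 0 < x + (k + e)%:~R * s].
Proof.
move=> s0.
have [e es] : exists e : int, e%:~R * s = `|s|.
  have [h|h] := ltP 0 s; first by exists 1; rewrite gtr0_norm // mul1r.
  by exists (-1); rewrite ler0_norm // mulN1r.
have s1 : 0 < `|s| by rewrite normr_gt0.
exists (Num.floor (- x / `|s|) * e), e; split => //.
  by rewrite rmorphM /= -mulrA es -lerBrDl sub0r -ler_pdivlMr // Num.Theory.floor_le.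
rewrite -{2}[e]mul1r -mulrDl rmorphM /= -mulrA es -ltrBlDl sub0r -ltr_pdivrMr //.
exact: Num.Theory.floorD1_gt.
Qed.

Lemma progressions (R : realType) (c x s y t : R) : s != 0 -> t != 0 -> `|c| <= 1 ->
  (forall k m : int, 2 <= `|2 * c - (x + k%:~R * s) * (y + m%:~R * t)|) ->
  (forall m : int, y + m%:~R * t != 0) -> 8 <= `|s * t|.
Proof.
move=> s0 t0 c1 h y0.
have [k [e [es xk xk']]] := bracket x s0; have [m [f [ft ym ym']]] := bracket y t0.
pose p := - (x + k%:~R * s); pose q := x + (k + e)%:~R * s.
pose r := - (y + m%:~R * t); pose u := y + (m + f)%:~R * t.
have pq : `|s| = p + q by rewrite /p /q rmorphD /= mulrDl es; ring.
have ru : `|t| = r + u by rewrite /r /u rmorphD /= mulrDl ft; ring.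
rewrite normrM pq ru; apply: (@progressions_at_zero _ c) => //; rewrite /p /q /r /u ?opprK //.
- by rewrite oppr_ge0.
- by rewrite oppr_gt0 lt_neqAle y0.
- move=> /eqP; rewrite oppr_eq0 => /eqP xk0.
  have -> : - (x + (k + e)%:~R * s) = x + (k - e)%:~R * s.
    by rewrite rmorphD rmorphB /= !mulrDl mulNr; lra.
  by split.
Qed.

(** * The two parabolic generators *)

Definition S_pow (R : realType) (k : R) : 'M[R[i]]_2 := mx22 1 0 k%:C 1.

Lemma mx22_1 (R : realType) : mx22 1 0 0 1 = 1%:M :> 'M[R[i]]_2.
Proof. by apply: matrix2P; rewrite mx22E mxE. Qed.

Lemma T_mxD (R : realType) (x y : R[i]) : T_mx x *m T_mx y = T_mx (x + y).
Proof. by rewrite mulmx22; congr mx22; ring. Qed.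

Lemma S_powD (R : realType) (x y : R) : S_pow x *m S_pow y = S_pow (x + y).
Proof. by rewrite mulmx22; congr mx22; ring. Qed.

Lemma det_T (R : realType) (x : R[i]) : \det (T_mx x) = 1.
Proof. by rewrite det22 !mx22E; ring. Qed.

Lemma det_S_pow (R : realType) (x : R) : \det (S_pow x) = 1.
Proof. by rewrite det22 !mx22E; ring. Qed.

Lemma T_mx0 (R : realType) : T_mx 0 = 1%:M :> 'M[R[i]]_2.
Proof. by rewrite /T_mx mulr0 mx22_1. Qed.

Lemma S_pow0 (R : realType) : S_pow 0 = 1%:M :> 'M[R[i]]_2.
Proof. by rewrite -mx22_1. Qed.

Lemma S_pow1 (R : realType) : S_pow 1 = S_mx R.
Proof. by []. Qed.

Lemma inv_T (R : realType) (x : R[i]) : invmx (T_mx x) = T_mx (- x).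
Proof.
have u := unit_det1 (det_T x).
by apply: (can_inj (mulKmx u)); rewrite mulmxV // T_mxD subrr T_mx0.
Qed.

Lemma inv_S (R : realType) (x : R) : invmx (S_pow x) = S_pow (- x).
Proof.
have u := unit_det1 (det_S_pow x).
by apply: (can_inj (mulKmx u)); rewrite mulmxV // S_powD subrr S_pow0.
Qed.

Lemma act_T (R : realType) (a d p q : R) (m : R[i]) :
  act (T_mx m) (mx22 a%:C (p +i* q) (p -i* q) d%:C) =
  mx22 a%:C (p +i* q - 2 * a%:C * m) (p -i* q - 2 * a%:C * m^*)
    (d - 4 * (p * complex.Re m + q * complex.Im m) + 4 * a * (complex.Re m ^+ 2
      + complex.Im m ^+ 2))%:C.
Proof.
rewrite /act inv_T; case: m => m n /=.
have -> : ctr (T_mx (- (m +i* n))) = mx22 1 0 (2 * - (m -i* n)) 1.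
  by apply: matrix2P; rewrite !mxE //=; apply/eqP; rewrite eq_complex /=; apply/andP; split;
    apply/eqP; ring.
rewrite !mulmx22; apply: matrix2P; rewrite !mx22E.
all: by apply/eqP; rewrite eq_complex /=; apply/andP; split; apply/eqP; ring.
Qed.

Lemma act_S (R : realType) (a d p q k : R) :
  act (S_pow k) (mx22 a%:C (p +i* q) (p -i* q) d%:C) =
  mx22 (a - 2 * k * p + k ^+ 2 * d)%:C (p +i* q - (k * d)%:C) (p -i* q - (k * d)%:C) d%:C.
Proof.
rewrite /act inv_S.
have -> : ctr (S_pow (- k)) = mx22 1 (- k)%:C 0 1.
  by apply: matrix2P; rewrite !mxE //=; apply/eqP; rewrite eq_complex /=; apply/andP; split;
    apply/eqP; ring.
rewrite !mulmx22; apply: matrix2P; rewrite !mx22E.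
all: by apply/eqP; rewrite eq_complex /=; apply/andP; split; apply/eqP; ring.
Qed.

(** The condition [pa_fix] comes from [ip (T P) P = 1 - 2 a^2 |lam|^2], where [a] is the upper
    left entry of [P]. *)
Lemma parabolic_T (R : realType) (lam : R[i]) : lam != 0 ->
  parabolic (fun k => T_mx (k%:~R * lam)) 0 1
    (fun b => - 4 * complex.Re (b * lam^*)).
Proof.
move=> lam0; have n0 := sqr_ReIm_gt0 lam0.
split => //.
- by move=> k; exact: det_T.
- by move=> k; rewrite !T_mxD addrC.
- case=> /(congr1 (fun M : 'M[R[i]]_2 => M 0 1)); rewrite mx22E !mxE /= ?oppr0 mul1r => /eqP;
  by rewrite mulf_eq0 (negPf lam0) orbF pnatr_eq0.
- move=> P /discE[a [d [p [q [-> E]]]]]; rewrite mul1r act_T /ip !mx22E.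
  case: lam lam0 n0 => l1 l2 _ /= n0 h.
  have h1 : a ^+ 2 * (l1 ^+ 2 + l2 ^+ 2) <= 0.
    move: h; set X := (X in 1 <= X).
    have -> : X = p ^+ 2 + q ^+ 2 - a * d - 2 * (a ^+ 2 * (l1 ^+ 2 + l2 ^+ 2)).
      by rewrite /X; field.
    by rewrite E; lra.
  have : a ^+ 2 <= 0 by move: h1; rewrite pmulr_lle0.
  by rewrite le_eqVlt ltNge sqr_ge0 orbF sqrf_eq0 => /eqP ->.
- move=> k P /discE[a [d [p [q [-> E]]]]]; rewrite act_T !mx22E => /(congr1 (@complex.Re R)) /= ->.
  rewrite !mulr0 !mul0r !subr0 !addr0; split => //=.
  case: lam {lam0 n0} => l1 l2 /=; rewrite -[k%:~R](rmorph_int (real_complex R)) /=; ring.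
Qed.

Lemma parabolic_S (R : realType) :
  parabolic (fun k => S_pow (k%:~R : R)) 1 0 (fun b => - 2 * complex.Re b).
Proof.
split => //.
- by move=> k; exact: det_S_pow.
- by move=> k; rewrite !S_powD addrC.
- case=> /(congr1 (fun M : 'M[R[i]]_2 => M 1 0)); rewrite mx22E !mxE /= ?oppr0 => /eqP;
  by rewrite eq_complex /= oner_eq0.
- move=> P /discE[a [d [p [q [-> E]]]]]; rewrite act_S /ip !mx22E /= => h.
  have h1 : d ^+ 2 <= 0.
    move: h; set X := (X in 1 <= X).
    have -> : X = p ^+ 2 + q ^+ 2 - a * d - d ^+ 2 / 2 by rewrite /X; field.
    by rewrite E; lra.
  by move: h1; rewrite le_eqVlt ltNge sqr_ge0 orbF sqrf_eq0 => /eqP ->.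
- move=> k P /discE[a [d [p [q [-> E]]]]]; rewrite act_S !mx22E => /(congr1 (@complex.Re R)) /= ->.
  by rewrite !mulr0 !subr0 !addr0; split => //=; ring.
Qed.

(** Two conjugates of letters that have a common disc on their axes, with the same
    orientation, are equal. *)
Lemma common_axis (R : realType) (g M : letter -> 'M[R[i]]_2) u v x y A B :
  pingpong g M -> act (ev g u) (M x) = act (ev g v) (M y) ->
  pm A (ev g u *m g x *m invmx (ev g u)) -> pm B (ev g v *m g y *m invmx (ev g v)) ->
  pm A B.
Proof.
move=> pp E; have du := det_ev u pp; have dv := det_ev v pp.
have := congr1 (act (invmx (ev g v))) E; rewrite actK // -actM ?det_invmx1 //.
have [w Ew] := inv_ev v pp; rewrite Ew -ev_cat => /(translate_eq_disc pp)[<-].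
rewrite ev_cat -Ew => e.
have -> : ev g u = ev g v.
  by rewrite -[RHS]mulmx1 -e mulmxA mulmxV ?mul1mx // unit_det1.
by move=> h1 /pm_sym; exact: pm_trans h1.
Qed.

(** * The lower bound for abstract ping-pong data *)

Lemma normc_of_sq (R : realType) (x : R[i]) (r : R) : complex.Re (x * x^*) = r ^+ 2 -> 0 <= r ->
  `|x| = r%:C.
Proof.
move=> h r0; rewrite normc_def.
have -> : complex.Re x ^+ 2 + complex.Im x ^+ 2 = r ^+ 2 by rewrite -h; case: (x) => ? ? /=; ring.
by rewrite sqrtr_sqr ger0_norm.
Qed.

Lemma ip_line_tangent (R : realType) (P Q : 'M[R[i]]_2) : disc P -> disc Q ->
  P 0 0 = 0 -> Q 1 1 = 0 ->
  [/\ `|P 0 1| = 1, `|Q 0 1| = 1, `|complex.Re (P 0 1 * (Q 0 1)^*)| <= 1 &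
  2 * ip P Q = 2 * complex.Re (P 0 1 * (Q 0 1)^*) - complex.Re (P 1 1) * complex.Re (Q 0 0)].
Proof.
move=> /discE[a [d [p [q [-> E]]]]] /discE[a' [d' [p' [q' [-> E']]]]].
rewrite /ip !mx22E => /(congr1 (@complex.Re R)) /= a0 /(congr1 (@complex.Re R)) /= d0.
rewrite a0 mul0r addr0 in E; rewrite d0 mulr0 addr0 in E'; split.
- by apply: normc_of_sq; rewrite /= ?expr1n; lra.
- by apply: normc_of_sq; rewrite /= ?expr1n; lra.
- rewrite -(@ler_pXn2r _ 2) ?nnegrE // expr1n -normrX ger0_norm ?sqr_ge0 //.
  set X := (X in X ^+ 2 <= 1); have -> : X ^+ 2 = (p ^+ 2 + q ^+ 2) * (p' ^+ 2
    + q' ^+ 2) - (p * q' - q * p') ^+ 2.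
    by rewrite /X; ring.
  by rewrite E E' mulr1 gerBl sqr_ge0.
- by rewrite a0 d0; field.
Qed.

Lemma shared_line (R : realType) (P Q : 'M[R[i]]_2) : disc P -> disc Q ->
  P 0 0 = 0 -> complex.Re (P 1 1) = 0 -> Q 1 1 = 0 -> complex.Re (Q 0 0) = 0 ->
  1 <= `|ip P Q| -> Q = P \/ Q = - P.
Proof.
move=> /discE[a [d [p [q [-> E]]]]] /discE[a' [d' [p' [q' [-> E']]]]].
rewrite /ip !mx22E => /(congr1 (@complex.Re R)) /= a0 /= d0 /(congr1 (@complex.Re R)) /= d0' /= a0'.
rewrite a0 mul0r addr0 in E; rewrite d0' mulr0 addr0 in E'.
rewrite a0 d0 a0' d0'.
have -> : (p * p' - q * - q' + (p * p' - - q * q') - (0 * 0 - 0 * 0) - (0 * 0 - 0 * 0)) / 2 =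
  p * p' + q * q' by field.
have sq (u v : R) : u ^+ 2 + v ^+ 2 <= 0 -> u = 0 /\ v = 0.
  move=> h; have u0 := sqr_ge0 u; have v0 := sqr_ge0 v.
  by split; apply/eqP; rewrite -sqrf_eq0; apply/eqP; lra.
rewrite ler_normr => /orP[] h; [left|right].
- have [|e1 e2] := sq (p' - p) (q' - q); first by rewrite !sqrrB; lra.
  by have [-> ->] : p' = p /\ q' = q by split; lra.
- have [|e1 e2] := sq (p' + p) (q' + q); first by rewrite !sqrrD; lra.
  have [-> ->] : p' = - p /\ q' = - q by split; lra.
  by apply: matrix2P; rewrite !mxE /=; apply/eqP; rewrite eq_complex /= ?oppr0 ?opprK !eqxx.
Qed.

(** Non-crossing of all the images of the two axis discs under powers of [T] and [S] is the
    hypothesis of [progressions], and the product of the two shifts is at most [8 |lam|]. *)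
Lemma pingpong_bound (R : realType) (g M : letter -> 'M[R[i]]_2) (lam : R[i]) :
  pingpong g M -> lam != 0 ->
  (forall k : int, words g (T_mx (k%:~R * lam))) ->
  (forall k : int, words g (S_pow (k%:~R : R))) -> 1 <= `|lam|.
Proof.
move=> pp lam0 wT wS.
have [P [tP P0 tau0 HP]] := parabolic_axis pp (parabolic_T lam0) wT.
have [Q [tQ Q0 sig0 HQ]] := parabolic_axis pp (parabolic_S R) wS.
have dP := translate_disc pp tP; have dQ := translate_disc pp tQ.
have [nP nQ c1 _] := ip_line_tangent dP dQ P0 Q0.
set c := complex.Re _ in c1.
set tau := _ * _ in tau0 HP; set sig := _ * _ in sig0 HQ.
set d := complex.Re _ in HP; set a := complex.Re _ in HQ.
have key (k m : int) : 2 <= `|2 * c - (d + k%:~R * tau) * (a + m%:~R * sig)|.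
  have [eP0 eP1 eP2] := pa_shift (parabolic_T lam0) k dP P0.
  have [eQ0 eQ1 eQ2] := pa_shift (parabolic_S R) m dQ Q0.
  have tP' := translate_act pp (wT k) tP; have tQ' := translate_act pp (wS m) tQ.
  have := noncrossing pp tP' tQ'.
  have [_ _ _] := ip_line_tangent (translate_disc pp tP') (translate_disc pp tQ') eP0 eQ0.
  rewrite eP1 eP2 eQ1 eQ2 -/tau -/sig -/d -/a -/c => <- h.
  by rewrite normrM (@ger0_norm _ 2) // -[leLHS]mulr1 ler_pM2l.
(* |tau| = 4 |Re (b conj lam)| and |sig| = 2 |Re b'|, with b and b' of modulus 1 *)
have small : 8 <= `|tau * sig| -> 1 <= `|lam|.
  have lamE : (complex.Re `|lam|)%:C = `|lam| by rewrite RRe_real // normr_real.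
  have t1 : `|complex.Re (P 0 1 * lam^*)| <= complex.Re `|lam|.
    by rewrite -lecR lamE; apply: le_trans (normc_ge_Re _) _; rewrite normrM nP mul1r normcJ.
  have s1 : `|complex.Re (Q 0 1)| <= 1.
    by rewrite -lecR; apply: le_trans (normc_ge_Re _) _; rewrite nQ.
  move=> h; rewrite -lamE lecR.
  have : `|tau * sig| = 8 * (`|complex.Re (P 0 1 * lam^*)| * `|complex.Re (Q 0 1)|).
    rewrite /tau /sig !normrM !normrN (@ger0_norm _ 4) // (@ger0_norm _ 2) //; ring.
  move: h t1 s1 (normr_ge0 (complex.Re (Q 0 1))) (normr_ge0 (complex.Re (P 0 1 * lam^*))).
  move: `|tau * sig| `|complex.Re (Q 0 1)| `|complex.Re (P 0 1 * lam^*)| (complex.Re `|lam|).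
  by clear; move=> x y z n h zn y1 y0 z0 e; nra.
case: HP => [aP|[d0 [u [x [EP uT]]]]].
  apply: small; rewrite mulrC; apply: (@progressions _ c a _ d) => // k m.
  by rewrite [X in _ - X]mulrC; exact: key.
case: HQ => [aQ|[a0 [v [y [EQ vS]]]]].
  by apply: small; exact: (@progressions _ c d tau a sig).
exfalso; rewrite mul1r in uT.
(* both orbits meet 0: T is upper triangular, S is not *)
have lower (A B : 'M[R[i]]_2) : A 1 0 = 0 -> B 1 0 != 0 -> ~ pm A B.
  move=> A0 B0 [] /(congr1 (fun M : 'M[R[i]]_2 => M 1 0)); rewrite A0.
    by move=> e; rewrite -e eqxx in B0.
  by rewrite mxE => /esym/eqP; rewrite oppr_eq0 (negPf B0).
have T10 : T_mx lam 1 0 = 0 by rewrite mx22E.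
case: (shared_line dP dQ P0 d0 Q0 a0 (noncrossing pp tP tQ)) => QP.
  apply: (lower _ _ T10) (common_axis pp _ uT vS); last by rewrite -EP -EQ.
  by rewrite mx22E; apply/eqP => /eqP; rewrite eq_complex /= oner_eq0.
(* opposite orientations are made equal by replacing S with its inverse *)
have dv := det_ev v pp.
have S10 : S_pow (-1) 1 0 != 0 :> R[i].
  by rewrite mx22E; apply/eqP => /eqP; rewrite eq_complex /= oppr_eq0 oner_eq0.
apply: (lower _ _ T10 S10).
apply: (common_axis pp (u := u) (x := x) (v := rcons v y) (y := linv y) _ uT).
  by rewrite -EP ev_rcons (actM _ dv (pp_det pp y)) (pp_act pp) actN -EQ QP opprK.
have dy := pp_det pp y.
rewrite ev_rcons (pp_inv pp y) -(mulmxA (ev g v)) (mulmxV (unit_det1 dy)) mulmx1.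
rewrite (invmxM1 dv dy) mulmxA -(invmx_conj dv dy).
rewrite -inv_S; case: vS => [<-|->]; first by left.
by right; rewrite invmxN2 // !det_mulmx det_invmx1 // dv dy !mulr1.
Qed.

(** * From discs on the sphere to ping-pong data *)

Definition hcoord (R : realType) (w : sphere R) : 'cV[R[i]]_2 :=
  if w is Some z then cvec z 1 else cvec 1 0.

Definition region (R : realType) (M : 'M[R[i]]_2) : set (sphere R) :=
  [set w | hval M (hcoord w) < 0].

Definition zeros (R : realType) (M : 'M[R[i]]_2) : set (sphere R) :=
  [set w | hval M (hcoord w) = 0].

Lemma hvalZ (R : realType) (M : 'M[R[i]]_2) (k : R[i]) x : herm M ->
  hval M (k *: x) = complex.Re (k * k^*) * hval M x.
Proof.
move=> /hermE[a [d [b ->]]]; rewrite (cvec_eta x).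
have -> : k *: cvec (x 0 0) (x 1 0) = cvec (k * x 0 0) (k * x 1 0).
  by apply/matrixP => i j; rewrite !mxE; case: ifP.
rewrite !hvalE; case: (x 0 0) => ? ?; case: (x 1 0) => ? ?; case: k => ? ?; case: b => ? ? /=.
ring.
Qed.

Lemma ReJ_gt0 (R : realType) (k : R[i]) : k != 0 -> 0 < complex.Re (k * k^*).
Proof.
move=> /sqr_ReIm_gt0; case: k => x y /=.
by have -> : x * x - y * - y = x ^+ 2 + y ^+ 2 by ring.
Qed.

Lemma hcoord_surj (R : realType) (x : 'cV[R[i]]_2) : x != 0 ->
  exists k w, k != 0 /\ x = k *: hcoord w.
Proof.
move=> x0; have [x1|x1] := eqVneq (x 1 0) 0.
  exists (x 0 0), None; split.
    by apply: contra_neq x0 => e; rewrite (cvec_eta x) e x1; apply/matrixP => i j;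
      rewrite !mxE; case: ifP.
  by rewrite [LHS]cvec_eta x1; apply/matrixP => i j; rewrite !mxE; case: ifP; rewrite ?mulr1 ?mulr0.
exists (x 1 0), (Some (x 0 0 / x 1 0)); split => //.
by rewrite [LHS]cvec_eta; apply/matrixP => i j; rewrite !mxE; case: ifP;
  rewrite ?mulr1 ?[_ * (_ / _)]mulrC ?divfK.
Qed.

Lemma hcoord_neq0 (R : realType) (w : sphere R) : hcoord w != 0.
Proof.
apply/eqP; case: w => [z|] /matrixP e.
  by have := e 1 0; rewrite !mxE /= => /eqP; rewrite oner_eq0.
by have := e 0 0; rewrite !mxE /= => /eqP; rewrite oner_eq0.
Qed.

Lemma hcoord_inj (R : realType) (k : R[i]) (w w' : sphere R) :
  hcoord w = k *: hcoord w' -> w = w'.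
Proof.
case: w => [z|]; case: w' => [z'|] // /matrixP e; have := e 0 0; have := e 1 0;
  rewrite !mxE /= ?mulr1 ?mulr0.
- by move=> <- ->; rewrite mul1r.
- by move=> /eqP; rewrite oner_eq0.
- by move=> <- /eqP; rewrite mul0r oner_eq0.
Qed.

Lemma mobius_hcoord (R : realType) (g : 'M[R[i]]_2) w : \det g = 1 ->
  exists k, k != 0 /\ g *m hcoord w = k *: hcoord (mobius g w).
Proof.
move=> dg; have v0 : g *m hcoord w != 0.
  apply: contra_neq (hcoord_neq0 w) => e.
  by rewrite -(mulKmx (unit_det1 dg) (hcoord w)) e mulmx0.
suff -> : mobius g w = if (g *m hcoord w) 1 0 == 0 then None
    else Some ((g *m hcoord w) 0 0 / (g *m hcoord w) 1 0).
  have [k [w' [k0 e]]] := hcoord_surj v0; exists k; split => //; rewrite {1}e;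
    congr (_ *: hcoord _).
  rewrite e; case: w' {e} => [z|]; rewrite !mxE /= ?mulr0 ?eqxx //.
  by rewrite mulr1 (negPf k0) mulrC mulrA mulVf // mul1r.
by case: w {v0} => [z|] /=; rewrite !mxE !sum_ord2 !mxE /= ?mulr1 ?mulr0 ?addr0.
Qed.

Lemma mobius_surj (R : realType) (g : 'M[R[i]]_2) w : \det g = 1 ->
  exists u, mobius g u = w.
Proof.
move=> dg; have ug := unit_det1 dg.
have [k [k0 e]] := mobius_hcoord w (det_invmx1 dg).
have [l [l0 e']] := mobius_hcoord (mobius (invmx g) w) dg.
exists (mobius (invmx g) w); apply/esym; apply: (@hcoord_inj _ (k * l)).
by rewrite -(mulKVmx ug (hcoord w)) e -scalemxAr e' scalerA.
Qed.

Lemma hval_mobius (R : realType) (g M : 'M[R[i]]_2) w : \det g = 1 -> herm M ->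
  exists c : R, 0 < c /\ hval M (hcoord w) = c * hval (act g M) (hcoord (mobius g w)).
Proof.
move=> dg hM; have [k [k0 e]] := mobius_hcoord w dg.
exists (complex.Re (k * k^*)); split; first exact: ReJ_gt0.
by rewrite -(hvalZ k _ (herm_act g hM)) -e hval_act mulKmx ?unit_det1.
Qed.

Lemma regionN (R : realType) (M : 'M[R[i]]_2) w : region (- M) w <-> 0 < hval M (hcoord w).
Proof. by rewrite /region /= hvalN oppr_lt0. Qed.

Lemma zerosN (R : realType) (M : 'M[R[i]]_2) : zeros (- M) = zeros M.
Proof.
apply/seteqP; split => w; rewrite /zeros /= hvalN => /eqP; rewrite ?oppr_eq0 => /eqP //.
by move=> ->; rewrite oppr0.
Qed.

(** Every nonzero vector is a multiple of the homogeneous coordinates of a point, and the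
    sign of a Hermitian form is the same on a line. *)
Lemma disjoint_away (R : realType) (M N : 'M[R[i]]_2) : disc M -> disc N ->
  [disjoint region M & region N] -> away M N.
Proof.
move=> dM dN /disj_set2P MN; apply: away_closed => // x.
have [->|x0] := eqVneq x 0; first by rewrite /hval !mulmx0 mxE.
have [k [w [k0 ->]]] := hcoord_surj x0.
rewrite (hvalZ _ _ dM.1) (hvalZ _ _ dN.1) pmulr_rlt0 ?pmulr_rge0 ?ReJ_gt0 // => Mw.
rewrite leNgt; apply/negP => Nw.
by have : (region M `&` region N) w by []; rewrite MN.
Qed.

(** The disc [U] is determined by the first disc of the pair and by the pairing map, so
    its form can be chosen to make the relation [pp_act] an exact equality. *)
Lemma paired_region (R : realType) (g M : 'M[R[i]]_2) (K U : set (sphere R)) :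
  \det g = 1 -> disc M -> pairs g (zeros M) (region M) K U -> U `<=` ~` K ->
  U = region (- act g M).
Proof.
move=> dg dM [gK gU] UK.
have sgn u : exists c : R, 0 < c /\ hval M (hcoord u) = c * hval (act g M) (hcoord (mobius g u)).
  by apply: hval_mobius => //; exact: dM.1.
apply/seteqP; split => w; have [u uw] := mobius_surj w dg; have [c [c0 e]] := sgn u;
  rewrite uw in e; rewrite regionN.
  move=> Uw; have [h|h|h] := ltgtP (hval M (hcoord u)) 0.
  - have : exterior K U w by rewrite -gU; exists u.
    by case; right.
  - by move: h; rewrite e pmulr_rgt0.
  - by case: (UK _ Uw); rewrite -gK; exists u.
move=> h; apply: contrapT => nU; have [Kw|nK] := pselect (K w).
  move: Kw; rewrite -gK => -[u' u'0 u'w]; rewrite /zeros /= in u'0.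
  have [c' [c'0 e']] := sgn u'; rewrite u'w in e'.
  by have := mulr_gt0 c'0 h; rewrite -e' u'0 ltxx.
have : exterior K U w by case.
rewrite -gU => -[u' u'0 u'w]; rewrite /region /= in u'0.
have [c' [c'0 e']] := sgn u'; rewrite u'w in e'.
by have := mulr_gt0 c'0 h; rewrite -e' => /(lt_trans u'0); rewrite ltxx.
Qed.

Lemma generated_group (R : realType) (g1 g2 : 'M[R[i]]_2) : \det g1 = 1 -> \det g2 = 1 ->
  PSL2_subgroup (PSL2_generated g1 g2).
Proof.
move=> d1 d2; split.
- move=> g h; apply: (h (fun g => \det g = 1)); split; last by move=> _ [->|->].
  split => //; [exact: det1| |exact: det_invmx1|by move=> *; rewrite detN2].
  by move=> x y ex ey; rewrite det_mulmx ex ey mulr1.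
- by move=> A [[]].
- by move=> x y hx hy A A0; have [[_ _ h _ _] _] := A0; apply: h; [exact: hx|exact: hy].
- by move=> x hx A A0; have [[_ _ _ h _] _] := A0; apply: h; exact: hx.
- by move=> x hx A A0; have [[_ _ _ _ h] _] := A0; apply: h; exact: hx.
Qed.

Lemma generated_words (R : realType) (g M : letter -> 'M[R[i]]_2) h : pingpong g M ->
  PSL2_generated (g (false, false)) (g (true, false)) h -> words g h.
Proof.
move=> pp; apply; split; last first.
  by move=> _ [->|->]; [exists [:: (false, false)]|exists [:: (true, false)]]; left;
    rewrite /= mulmx1.
split.
- by move=> x [w [->|->]]; rewrite ?detN2 (det_ev _ pp).
- by exists [::]; left.
- by move=> x y [u xu] [v yv]; exists (u ++ v); rewrite ev_cat; exact: pmM.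
- move=> x [u xu]; have [u' e] := inv_ev u pp; exists u'; rewrite -e.
  by case: xu => ->; [left|right; rewrite invmxN2 ?(det_ev _ pp)].
- by move=> x [u [->|->]]; exists u; [right|left; rewrite opprK].
Qed.

Lemma powers_in_G (R : realType) (lam : R[i]) (k : int) :
  G_ lam (T_mx (k%:~R * lam)) /\ G_ lam (S_pow (k%:~R : R)).
Proof.
have [_ G1 GM GV _] := generated_group (det_S_pow (1 : R)) (det_T lam).
have gS : G_ lam (S_pow 1) by move=> A [_ ]; apply; left.
have gT : G_ lam (T_mx lam) by move=> A [_ ]; apply; right.
have nat n : G_ lam (T_mx (n%:R * lam)) /\ G_ lam (S_pow (n%:R : R)).
  elim: n => [|n [IT IS]]; first by rewrite mul0r T_mx0 S_pow0.
  by rewrite -!natr1 mulrDl mul1r -T_mxD -S_powD; split; exact: GM.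
case: k => n; first by have := nat n; rewrite -!pmulrn.
have [hT hS] := nat n.+1; have := conj (GV _ hT) (GV _ hS).
by rewrite inv_T inv_S NegzE !rmorphN /= mulNr.
Qed.

Lemma paired_discs_bound (R : realType) (lam : R[i]) (g1 g2 M N : 'M[R[i]]_2)
   (C2 D2 U2 V2 : set (sphere R)) :
  lam != 0 -> \det g1 = 1 -> \det g2 = 1 -> G_ lam = PSL2_generated g1 g2 ->
  disc M -> disc N -> U2 `<=` ~` C2 -> V2 `<=` ~` D2 ->
  [/\ [disjoint region M & U2], [disjoint region N & V2] &
     [/\ [disjoint region M & region N], [disjoint region M & V2],
         [disjoint U2 & region N] & [disjoint U2 & V2]]] ->
  pairs g1 (zeros M) (region M) C2 U2 -> pairs g2 (zeros N) (region N) D2 V2 ->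
  1 <= `|lam|.
Proof.
move=> lam0 d1 d2 EG dM dN UC VD + p1 p2.
rewrite (paired_region d1 dM p1 UC) (paired_region d2 dN p2 VD).
have dM' := discN (disc_act d1 dM); have dN' := discN (disc_act d2 dN).
move=> [dU dV [dUV dUV' dU'V dU'V']].
pose g (l : letter) := let h := if l.1 then g2 else g1 in if l.2 then invmx h else h.
pose X (l : letter) := if l.1 then (if l.2 then N else - act g2 N)
  else (if l.2 then M else - act g1 M).
have pp : pingpong g X.
  have sym (P Q : 'M[R[i]]_2) : disc P -> disc Q -> [disjoint region P & region Q] ->
      away P Q /\ away Q P.
    by move=> dP dQ dd; have h := disjoint_away dP dQ dd; split => //; exact: away_sym.
  have [s1 s1'] := sym _ _ dM dM' dU.
  have [s2 s2'] := sym _ _ dN dN' dV.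
  have [s3 s3'] := sym _ _ dM dN dUV.
  have [s4 s4'] := sym _ _ dM dN' dUV'.
  have [s5 s5'] := sym _ _ dM' dN dU'V.
  have [s6 s6'] := sym _ _ dM' dN' dU'V'.
  split.
  - by case=> [[] []]; rewrite /g /= ?det_invmx1.
  - by case=> [[] []]; rewrite /g /= ?invmxK.
  - by case=> [[] []]; rewrite /X /=; [exact: dN|exact: dN'|exact: dM|exact: dM'].
  - case=> [[] []]; rewrite /g /X /=; last by rewrite opprK.
    + by rewrite actN actK.
    + by rewrite opprK.
    + by rewrite actN actK.
  - case=> [[] []] [[] []] ll'; rewrite /X /=; try (exfalso; exact: (negP ll' (eqxx _))).
    + exact: s2.
    + exact: s3'.
    + exact: s5'.
    + exact: s2'.
    + exact: s4'.
    + exact: s6'.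
    + exact: s3.
    + exact: s4.
    + exact: s1.
    + exact: s5.
    + exact: s6.
    + exact: s1'.
apply: (pingpong_bound pp lam0) => k; apply: (generated_words pp).
  by rewrite /g /= -EG; exact: (powers_in_G lam k).1.
by rewrite /g /= -EG; exact: (powers_in_G lam k).2.
Qed.

(** * Complementary components of circles *)

Lemma gt0_complexE (R : realType) (e : R[i]) : 0 < e -> exists2 r : R, 0 < r & e = r%:C.
Proof.
case: e => a b; rewrite ltcE /= => /andP[/eqP b0 a0]; exists a => //.
by rewrite b0.
Qed.

Lemma normc_le_ReIm (R : realType) (x : R[i]) :
  `|x| <= (`|complex.Re x| + `|complex.Im x|)%:C.
Proof.
have nr (a : R) : `|a%:C| = `|a|%:C by rewrite normc_def /= expr0n addr0 sqrtr_sqr.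
have ni : `|'i%C| = 1 :> R[i] by rewrite normc_def /= expr0n /= expr1n add0r sqrtr1.
by rewrite {1}(complexE x); apply: le_trans (ler_normD _ _) _; rewrite normrM ni mul1r !nr rmorphD.
Qed.

Lemma continuous_ReIm (R : realType) (T : topologicalType) (F : T -> (R[i])^o) :
  continuous (fun t => complex.Re (F t)) -> continuous (fun t => complex.Im (F t)) ->
  continuous F.
Proof.
move=> cr ci t; apply/cvgrPdist_lt => e /gt0_complexE[r r0 ->].
have r2 : 0 < r / 2 by rewrite divr_gt0.
have /cvgrPdist_lt/(_ _ r2) hr := cr t; have /cvgrPdist_lt/(_ _ r2) hi := ci t.
near=> s; apply: le_lt_trans (normc_le_ReIm _) _; rewrite ltcR [r]splitr ltrD //.
  have : `|complex.Re (F t) - complex.Re (F s)| < r / 2 by near: s.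
  by case: (F t) => ? ?; case: (F s).
have : `|complex.Im (F t) - complex.Im (F s)| < r / 2 by near: s.
by case: (F t) => ? ?; case: (F s).
Unshelve. all: by end_near. Qed.

Lemma continuous_Re (R : realType) : continuous (@complex.Re R : (R[i])^o -> R).
Proof.
move=> z; apply/(@cvgrPdist_lt _ _ _ _ (nbhs_filter (z : (R[i])^o))) => e e0.
have h := @nbhsx_ballx _ (R[i])^o z e%:C.
have /h {}h : 0 < e%:C by rewrite ltcR.
near=> s; have : `|z - s| < e%:C by near: s.
move/(le_lt_trans (normc_ge_Re _)); rewrite ltcR.
by case: (z) => ? ?; case: (s).
Unshelve. all: by end_near. Qed.

Lemma continuous_Im (R : realType) : continuous (@complex.Im R : (R[i])^o -> R).
Proof.
move=> z; apply/(@cvgrPdist_lt _ _ _ _ (nbhs_filter (z : (R[i])^o))) => e e0.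
have h := @nbhsx_ballx _ (R[i])^o z e%:C.
have /h {}h : 0 < e%:C by rewrite ltcR.
near=> s; have : `|z - s| < e%:C by near: s.
move=> h1; have ni : `|- 'i%C| = 1 :> R[i].
  by rewrite normrN normc_def /= expr0n /= expr1n add0r sqrtr1.
have : `|- 'i%C * ((z : R[i]) - s)| < e%:C by rewrite normrM ni mul1r.
move/(le_lt_trans (normc_ge_Re _)); rewrite ltcR.
have -> // : complex.Re (- 'i%C * ((z : R[i]) - s)) = complex.Im z - complex.Im s.
by case: (z) => ? ?; case: (s) => ? ? /=; ring.
Unshelve. all: by end_near. Qed.

(** Stated over an arbitrary space, so as to be used with the real and imaginary parts as
    [u] and [v]. *)
Lemma continuous_quadratic (R : realType) (T : topologicalType) (u v : T -> R) (a b c d : R) :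
  continuous u -> continuous v ->
  continuous (fun t => a * (u t * u t + v t * v t) + (b * u t + c * v t) + d).
Proof.
move=> cu cv t; apply: cvgD; last exact: cvg_cst.
apply: cvgD.
  by apply: cvgM; [exact: cvg_cst|apply: cvgD; apply: cvgM; (exact: cu) || exact: cv].
by apply: cvgD; apply: cvgM; (exact: cvg_cst) || (exact: cu) || exact: cv.
Qed.

Lemma continuous_hval (R : realType) (M : 'M[R[i]]_2) : herm M ->
  continuous (fun z : (R[i])^o => hval M (cvec z 1)).
Proof.
move=> /hermE[a [d [[p q] ->]]].
have -> : (fun z : (R[i])^o => hval (mx22 a%:C (p +i* q) (p +i* q)^* d%:C) (cvec z 1)) =
  (fun z : (R[i])^o => a * (complex.Re z * complex.Re z + complex.Im z * complex.Im z) +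
     (2 * p * complex.Re z + 2 * q * complex.Im z) + d).
  by apply/funext => -[x y]; rewrite hvalE /=; ring.
exact: (@continuous_quadratic R ((R[i])^o : topologicalType) _ _ a (2 * p) (2 * q) d (@continuous_Re R) (@continuous_Im R)).
Qed.

Lemma open_disc_some (R : realType) (M : 'M[R[i]]_2) : herm M ->
  open [set z : (R[i])^o | hval M (cvec z 1) < 0].
Proof.
move=> hM; have := continuous_hval hM; move/continuousP => /(_ [set x | x < 0]).
by apply; exact: open_lt.
Qed.

Lemma compact_bounded_disc (R : realType) (r : R) (A : set (R[i])^o) : closed A ->
  (forall z, A z -> complex.Re z ^+ 2 + complex.Im z ^+ 2 <= r) -> compact A.
Proof.
move=> cA Ar; pose box := `[- (r + 1), r + 1]%classic `*` `[- (r + 1), r + 1]%classic : set (R * R).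
have cbox : compact box by apply: compact_setX; exact: segment_compact.
have cF : continuous (fun xy : R * R => xy.1 +i* xy.2 : (R[i])^o).
  by apply: continuous_ReIm => xy /=; [exact: cvg_fst|exact: cvg_snd].
apply: subclosed_compact cA (continuous_compact (continuous_subspaceT cF) cbox) _.
move=> [x y] /Ar /= h; exists (x, y) => //; split; rewrite /= in_itv /= -ler_norml.
- by rewrite -(@ler_pXn2r _ 2) ?nnegrE ?real_normK ?num_real //; nra.
- by rewrite -(@ler_pXn2r _ 2) ?nnegrE ?real_normK ?num_real //; nra.
Qed.

Lemma open_region (R : realType) (M : 'M[R[i]]_2) : herm M -> open (region M).
Proof.
move=> hM; rewrite openE => -[z|] /= wM.
  change (nbhs (z : (R[i])^o) [set z | hval M (cvec z 1) < 0]).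
  exact: open_nbhs_nbhs (conj (open_disc_some hM) wM).
have [a [d [[p q] ME]]] := hermE hM.
have a0 : a < 0 by move: wM; rewrite /region /= ME hvalE /=; lra.
exists [set z | ~ (hval M (cvec z 1) < 0)]; last first.
  by move=> _ [[u /contrapT Mu <-]|->].
have cl : closed ([set z | ~ (hval M (cvec z 1) < 0)] : set (R[i])^o).
  by apply: open_closedC; exact: open_disc_some.
split => //; apply: (compact_bounded_disc (r := 4 * (p ^+ 2 + q ^+ 2) / a ^+ 2 - 2 * d / a)) => //.
move=> [x y] /= /negP; rewrite -leNgt ME hvalE /= => h.
have a2 : 0 < a ^+ 2 by rewrite exprn_even_gt0 //= lt_eqF.
have -> : 4 * (p ^+ 2 + q ^+ 2) / a ^+ 2 - 2 * d / a =
    (4 * (p ^+ 2 + q ^+ 2) - 2 * a * d) / a ^+ 2 by field; rewrite lt_eqF.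
rewrite ler_pdivlMr //.
have := sqr_ge0 (a * x + 2 * p); have := sqr_ge0 (a * y + 2 * q); nra.
Qed.

Lemma connected_between (T : topologicalType) (A B : set T) :
  connected A -> A `<=` B -> B `<=` closure A -> connected B.
Proof.
move=> cA AB BA; apply/connectedP => E [E0 BE sE].
have := connected_subset sE; rewrite -BE => /(_ _ AB cA) h.
have [s1 s2] := sE; case: h => h.
  have [x Ex] := E0 true; have Bx : B x by rewrite BE; right.
  have : (closure (E false) `&` E true) x by split; [exact: closureS h _ (BA _ Bx)|].
  by rewrite s1.
have [x Ex] := E0 false; have Bx : B x by rewrite BE; left.
have : (E false `&` closure (E true)) x by split; [|exact: closureS h _ (BA _ Bx)].
by rewrite s2.
Qed.

Lemma connected_hub (T : topologicalType) (A : set T) (c : T) :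
  (forall x, A x -> exists B : set T, [/\ connected B, B c, B x & B `<=` A]) -> connected A.
Proof.
move=> h.
have [[x0 Ax0]|nA] := pselect (exists x, A x); last first.
  suff -> : A = set0 by exact: connected0.
  by apply/seteqP; split => // x Ax; case: nA; exists x.
have -> : A = \bigcup_(B in [set B | [/\ connected B, B c & B `<=` A]]) B.
  apply/seteqP; split => [x Ax|x [B [_ _ BA]]]; last exact: BA.
  by have [B [cB Bc Bx BA]] := h x Ax; exists B.
by apply: bigcup_connected => [|B [] //]; exists c => B [].
Qed.

Definition affine (R : realType) (c v : R[i]) (t : R) : sphere R := Some (c + t%:C * v).

Lemma continuous_affine (R : realType) (c v : R[i]) : continuous (affine c v).
Proof.
have h : continuous (fun t : R => c + t%:C * v : (R[i])^o).
  have lin (a b : R) : continuous (fun t : R => a + t * b).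
    by move=> t; apply: cvgD; [exact: cvg_cst|apply: cvgM; [exact: cvg_id|exact: cvg_cst]].
  apply: continuous_ReIm.
    have -> : (fun t : R => complex.Re (c + t%:C * v)) = (fun t => complex.Re c + t * complex.Re v).
      by apply/funext => t; case: (c) => ? ?; case: (v) => ? ? /=; ring.
    exact: lin.
  have -> : (fun t : R => complex.Im (c + t%:C * v)) = (fun t => complex.Im c + t * complex.Im v).
    by apply/funext => t; case: (c) => ? ?; case: (v) => ? ? /=; ring.
  exact: lin.
by move=> t; exact: (continuous_comp (h t) (@one_point_compactification_some_continuous (R[i])^o _)).
Qed.

Lemma connected_affine (R : realType) (c v : R[i]) (I : interval R) :
  connected (affine c v @` [set` I]).
Proof.
apply: connected_continuous_connected; last exact/continuous_subspaceT/continuous_affine.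
exact/connected_intervalP/interval_is_interval.
Qed.

(** A compact set of the plane is bounded, so it cannot contain the ray. *)
Lemma infty_in_ray (R : realType) (c v : R[i]) : v != 0 ->
  closure (affine c v @` `[1, +oo[%classic) None.
Proof.
move=> v0 W [C [cptC _] CW].
have : compact ((fun z : (R[i])^o => complex.Re z * complex.Re z
  + complex.Im z * complex.Im z) @` C).
  apply: continuous_compact => //; apply: continuous_subspaceT.
  have := @continuous_quadratic R ((R[i])^o : topologicalType) _ _ 1 0 0 0 (@continuous_Re R) (@continuous_Im R).
  by under eq_fun do rewrite mul1r !mul0r !addr0.
move/compact_bounded => [N [_ hN]].
pose A := complex.Re v ^+ 2 + complex.Im v ^+ 2.
pose B := 2 * (complex.Re c * complex.Re v + complex.Im c * complex.Im v).
have A0 : 0 < A := sqr_ReIm_gt0 v0.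
pose t := 1 + (`|B| + `|N| + 1) / A.
have t1 : 1 <= t by rewrite lerDl divr_ge0 ?(ltW A0) // !addr_ge0.
exists (affine c v t); split; first by exists t => //; rewrite /= in_itv /= t1.
apply: CW; left; exists (c + t%:C * v) => //= Cz.
have := hN (N + 1); rewrite ltrDl ltr01 => /(_ isT _ (imageP _ Cz)) /=.
set X := (X in `|X|); move/(le_trans (ler_norm X)); apply/negP; rewrite -ltNge.
have -> : X = t * (A * t + B) + (complex.Re c ^+ 2 + complex.Im c ^+ 2).
  by rewrite /X /A /B; case: (c) => ? ?; case: (v) => ? ? /=; ring.
have At : A * t = A + (`|B| + `|N| + 1) by rewrite /t mulrDr mulr1 mulrCA divff ?mulr1 // gt_eqF.
have := sqr_ge0 (complex.Re c); have := sqr_ge0 (complex.Im c).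
have NN := ler_norm N; have := ler_norm (- B); rewrite normrN => BB.
have : N + 1 < A * t + B by rewrite At; lra.
have : 0 < A * t + B by rewrite At; have := normr_ge0 N; lra.
nra.
Qed.

(** A disc or half-plane of the plane is convex; the outside of a circle is the union of
    the radial rays from its points, and all of them end at infinity. *)
Lemma connected_region (R : realType) (M : 'M[R[i]]_2) : disc M -> connected (region M).
Proof.
move=> dM; have [a [d [p [q [ME E]]]]] := discE dM.
have [a0|a0] := ltP a 0.
  apply: (connected_hub (c := (None : sphere R))) => -[z|] Mz; last first.
    by exists [set None]; split => //; [exact: connected1|move=> _ ->].
  pose k := - (a^-1)%:C * (p +i* q); pose v := z - k.
  have val (t : R) : hval M (cvec (k + t%:C * v) 1) =
      a * (complex.Re v ^+ 2 + complex.Im v ^+ 2) * t ^+ 2 - a^-1.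
    have -> : a^-1 = a^-1 * (p ^+ 2 + q ^+ 2 - a * d) by rewrite E addrK mulr1.
    rewrite ME (hvalE a d (p +i* q)) /v /k; case: (z) => x y /=; field; rewrite lt_eqF //.
  have Mv : hval M (hcoord (Some z)) = a * (complex.Re v ^+ 2 + complex.Im v ^+ 2) - a^-1.
    by have := val 1; rewrite expr1n mulr1 mul1r /v addrC subrK.
  have ai : a^-1 < 0 by rewrite invr_lt0.
  move: Mz; rewrite /region /= Mv => Mz.
  have v0 : v != 0.
    by apply/eqP => v0; move: Mz; rewrite v0 /= expr0n /= addr0 mulr0 sub0r oppr_lt0 ltNge ltW.
  exists (affine k v @` `[1, +oo[%classic `|` [set None]); split.
  - apply: (connected_between (A := affine k v @` `[1, +oo[%classic)).
    + exact: connected_affine.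
    + by move=> ? ?; left.
    move=> x [Ax|->]; first exact: subset_closure.
    exact: infty_in_ray.
  - by right.
  - left; exists 1; first by rewrite /= in_itv /= lexx.
    by rewrite /affine mul1r /v addrC subrK.
  - move=> x [[t t1 <-]|->]; rewrite /region /=; last by rewrite ME (hvalE a d (p +i* q)) /=; lra.
    rewrite val; move: t1; rewrite /= in_itv /= andbT => t1.
    have n0 : 0 <= complex.Re v ^+ 2 + complex.Im v ^+ 2 by rewrite addr_ge0 ?sqr_ge0.
    apply: le_lt_trans Mz; rewrite lerD2r;
      have : 1 <= t ^+ 2 by rewrite expr_ge1 // (le_trans _ t1).
    by move=> T1; rewrite -[leRHS]mulr1 ler_wnM2l // mulr_le0_ge0 // ltW.
have none : ~ region M None.
  by apply/negP; rewrite -leNgt ME (hvalE a d (p +i* q)) /=; lra.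
have [[z0 M0]|nA] := pselect (exists z, region M (Some z)); last first.
  suff -> : region M = set0 by exact: connected0.
  by apply/seteqP; split => // -[z|//] Az; case: nA; exists z.
apply: (connected_hub (c := (Some z0 : sphere R))) => -[z|//] Mz.
exists (affine z0 (z - z0) @` `[0, 1]%classic); split.
- exact: connected_affine.
- by exists 0; [rewrite /= in_itv /= lexx ler01|rewrite /affine mul0r addr0].
- by exists 1; [rewrite /= in_itv /= lexx ler01|rewrite /affine mul1r addrC subrK].
- move=> _ [t + <-]; rewrite /= in_itv /= => /andP[t0 t1]; move: Mz M0; rewrite /region /=.
  have -> : hval M (cvec (z0 + t%:C * (z - z0)) 1) = (1 - t) * hval M (cvec z0 1)
    + t * hval M (cvec z 1)
     - a * (t * (1 - t)) * (complex.Re (z - z0) ^+ 2 + complex.Im (z - z0) ^+ 2).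
    by rewrite ME !(hvalE a d (p +i* q)); case: (z) => ? ?; case: (z0) => ? ? /=; ring.
  move: (hval _ _) (hval _ _) => u w u0 w0.
  have : 0 <= a * (t * (1 - t)) * (complex.Re (z - z0) ^+ 2 + complex.Im (z - z0) ^+ 2).
    apply: mulr_ge0; last by rewrite addr_ge0 ?sqr_ge0.
    by apply: mulr_ge0; [exact: a0|apply: mulr_ge0; rewrite ?subr_ge0].
  move: (a * _ * _) => e e0; nra.
Qed.

(** The two sides of a circle are open and disjoint, hence separated, and both are
    connected. *)
Lemma component_region (R : realType) (M : 'M[R[i]]_2) w : disc M -> region M w ->
  connected_component (~` zeros M) w = region M.
Proof.
move=> dM Mw.
have MK : region M `<=` ~` zeros M.
  by move=> u; rewrite /region /zeros /= => h e; rewrite e ltxx in h.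
apply/seteqP; split; last by apply: connected_component_max => //; exact: connected_region.
have oM := open_region dM.1; have oN := open_region (hermN dM.1).
have dis u : region M u -> region (- M) u -> False.
  by rewrite regionN /region /= => h /(lt_trans h); rewrite ltxx.
have sep : separated (region M) (region (- M)).
  split; apply/seteqP; split => // u [].
    by move=> cu Nu; have [v [Mv Nv]] := cu _ (open_nbhs_nbhs (conj oN Nu)); exact: dis Mv Nv.
  by move=> Mu cu; have [v [Nv Mv]] := cu _ (open_nbhs_nbhs (conj oM Mu)); exact: dis Mv Nv.
have cover : connected_component (~` zeros M) w `<=` region M `|` region (- M).
  move=> u /connected_component_sub uK; have [h|h|h] := ltgtP (hval M (hcoord u)) 0.
  - by left.
  - by right; apply/regionN.
  - by case: uK.
have cc : connected (connected_component (~` zeros M) w) by exact: component_connected.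
have ww := connected_component_refl (MK _ Mw).
case: (connected_subset sep cover cc) => h; first exact: h.
by case: (dis w Mw (h w ww)).
Qed.

Lemma complementary_component_region (R : realType) (M : 'M[R[i]]_2) (U : set (sphere R)) :
  disc M -> complementary_component (zeros M) U ->
  exists N, [/\ disc N, zeros M = zeros N & U = region N].
Proof.
move=> dM [w nK ->].
have [h|h|h] := ltgtP (hval M (hcoord w)) 0; last by case: nK.
  by exists M; split => //; rewrite component_region.
exists (- M); split; [exact: discN|by rewrite zerosN|].
by rewrite -zerosN component_region //; [exact: discN|exact/regionN].
Qed.

(** The form |z - c|^2 - r^2, divided by r. *)
Definition circle_form (R : realType) (c : R[i]) (r : R) : 'M[R[i]]_2 :=
  mx22 (r^-1)%:C (- (r^-1)%:C * c) (- (r^-1)%:C * c^*)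
    (r^-1 * (complex.Re c ^+ 2 + complex.Im c ^+ 2 - r ^+ 2))%:C.

Lemma disc_circle (R : realType) (c : R[i]) (r : R) : 0 < r -> disc (circle_form c r).
Proof.
move=> r0; split.
  apply: matrix2P; rewrite !mxE /=; apply/eqP; rewrite eq_complex /=; case: (c) => ? ? /=;
  apply/andP; split; apply/eqP; ring.
rewrite det22 !mx22E; case: c => x y /=; apply/eqP; rewrite eq_complex /=.
by apply/andP; split; apply/eqP; field; rewrite gt_eqF.
Qed.

Lemma circle_formE (R : realType) (c : R[i]) (r : R) :
  circle_form c r = mx22 (r^-1)%:C (- (r^-1)%:C * c) (- (r^-1)%:C * c)^*
    (r^-1 * (complex.Re c ^+ 2 + complex.Im c ^+ 2 - r ^+ 2))%:C.
Proof.
rewrite /circle_form; congr mx22; case: c => ? ? /=; apply/eqP; rewrite eq_complex /=.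
by apply/andP; split; apply/eqP; ring.
Qed.

Lemma hval_circle (R : realType) (c z : R[i]) (r : R) :
  hval (circle_form c r) (cvec z 1) = r^-1 * (complex.Re ((z - c) * (z - c)^*) - r ^+ 2).
Proof.
by rewrite circle_formE hvalE; case: (c) => ? ?; case: (z) => ? ? /=; ring.
Qed.

Lemma hval_circle_infty (R : realType) (c : R[i]) (r : R) :
  hval (circle_form c r) (cvec 1 0) = r^-1.
Proof.
by rewrite circle_formE hvalE !mulr0 !mul0r /= !mulr0 !addr0 oppr0 mulr0 subr0 !mulr1.
Qed.

(** * Circles and lines; the lower bound *)

Lemma normc_sqP (R : realType) (x : R[i]) (r : R) : 0 <= r ->
  `|x| = r%:C <-> complex.Re (x * x^*) = r ^+ 2.
Proof.
move=> r0; split; last by move=> /normc_of_sq; apply.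
by move=> h; rewrite -sqr_normc h -rmorphXn.
Qed.

Lemma zeros_circle (R : realType) (c : R[i]) (r : R) : 0 < r ->
  zeros (circle_form c r) = Some @` [set z : R[i] | `|z - c| = r%:C].
Proof.
move=> r0; have ri : r^-1 != 0 by rewrite invr_neq0 // gt_eqF.
apply/seteqP; split=> [[z|] | _ [z /= zc <-]]; rewrite /zeros /=.
- move=> h; exists z => //; apply/normc_sqP; first exact: ltW.
  by move/eqP: h; rewrite hval_circle mulf_eq0 (negPf ri) /= subr_eq0 => /eqP.
- by rewrite hval_circle_infty => /eqP; rewrite (negPf ri).
- rewrite hval_circle; apply/eqP; rewrite mulf_eq0 (negPf ri) /= subr_eq0; apply/eqP.
  by apply/normc_sqP => //; exact: ltW.
Qed.

(** A normal vector of the line is obtained from its direction [v] by a quarter turn. *)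
Definition line_form (R : realType) (p v : R[i]) : 'M[R[i]]_2 :=
  let n := Num.sqrt (complex.Re v ^+ 2 + complex.Im v ^+ 2) in
  let b := (n^-1)%:C * ('i%C * v) in mx22 0%:C b b^* (- 2 * complex.Re (p^* * b))%:C.

Lemma sqrt_normE (R : realType) (v : R[i]) (n := Num.sqrt (complex.Re v ^+ 2 + complex.Im v ^+ 2)) :
  v != 0 -> 0 < n /\ n ^+ 2 = complex.Re v ^+ 2 + complex.Im v ^+ 2.
Proof.
move=> /sqr_ReIm_gt0 h.
by split; [rewrite sqrtr_gt0|rewrite sqr_sqrtr // ltW].
Qed.

Lemma disc_line (R : realType) (p v : R[i]) : v != 0 -> disc (line_form p v).
Proof.
move=> v0; have [] := sqrt_normE v0; rewrite /line_form.
move: (Num.sqrt _) => n n0 nE; split.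
  apply: matrix2P; rewrite !mxE /=; rewrite ?conjcK ?oppr0 //.
rewrite det22 !mx22E mul0r sub0r; congr (- _).
move: nE; case: (v) => x y /= nE; apply/eqP; rewrite eq_complex /=.
apply/andP; split; apply/eqP; last by ring.
transitivity ((x ^+ 2 + y ^+ 2) / n ^+ 2); first by field; rewrite gt_eqF.
by rewrite -nE; field; rewrite gt_eqF.
Qed.

Lemma hval_line (R : realType) (p v z : R[i]) :
  let n := Num.sqrt (complex.Re v ^+ 2 + complex.Im v ^+ 2) in
  hval (line_form p v) (cvec z 1) =
  2 / n * (complex.Re v * complex.Im (z - p) - complex.Im v * complex.Re (z - p)).
Proof.
rewrite /line_form; move: (Num.sqrt _) => n /=; rewrite hvalE.
by case: (v) => ? ?; case: (p) => ? ?; case: (z) => ? ? /=; ring.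
Qed.

Lemma hval_line_infty (R : realType) (p v : R[i]) :
  hval (line_form p v) (cvec 1 0) = 0.
Proof. by rewrite /line_form hvalE !mulr0 !mul0r /= !mulr0 !addr0. Qed.

Lemma zeros_line (R : realType) (p v : R[i]) : v != 0 ->
  zeros (line_form p v) = None |` (Some @` [set p + t%:C * v | t in [set: R]]).
Proof.
move=> v0; have [n0 nE] := sqrt_normE v0.
apply/seteqP; split=> [[z|] | w]; rewrite /zeros.
- rewrite /= hval_line => /eqP; rewrite mulf_eq0 mulf_eq0 invr_eq0 (gt_eqF n0) pnatr_eq0 /=
  => /eqP h.
  right; exists z => //.
  exists (((complex.Re v) * complex.Re (z - p) + complex.Im v * complex.Im (z - p)) /
    (complex.Re v ^+ 2 + complex.Im v ^+ 2)) => //.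
  have N0 : complex.Re v ^+ 2 + complex.Im v ^+ 2 != 0 by rewrite -nE expf_neq0 // gt_eqF.
  set t := (_ / _); suff e : t%:C * v = z - p by rewrite e addrC subrK.
  rewrite {}/t; move: h N0; move: (z - p) => u; case: (u) => x y; case: (v) => a b /= h N0.
  apply/eqP; rewrite eq_complex /=; apply/andP; split; apply/eqP.
    transitivity ((x * (a ^+ 2 + b ^+ 2) + b * (a * y - b * x)) / (a ^+ 2 + b ^+ 2)).
      by field.
    by rewrite h; field.
  transitivity ((y * (a ^+ 2 + b ^+ 2) - a * (a * y - b * x)) / (a ^+ 2 + b ^+ 2)).
    by field.
  by rewrite h; field.
- by left.
- case=> [->|[_ [t _ <-] <-]] /=.
    exact: hval_line_infty.
  rewrite hval_line [X in _ * X](_ : _ = 0) ?mulr0 //.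
  by case: (v) => ? ?; case: (p) => ? ? /=; ring.
Qed.

Lemma circle_zeros (R : realType) (K : set (sphere R)) : circle K ->
  exists2 M, disc M & K = zeros M.
Proof.
case=> [[c [r [r0 ->]]]|[p [v [v0 ->]]]].
  by exists (circle_form c r); [exact: disc_circle|rewrite zeros_circle].
by exists (line_form p v); [exact: disc_line|rewrite zeros_line].
Qed.

(** The circles C1 and D1 give Hermitian forms, and the forms of the other two discs are
    obtained from these through the pairings. *)
Lemma classical_T_Schottky_norm_ge1 (R : realType) (lam : R[i]) :
  lam != 0 -> classical_T_Schottky (G_ lam) -> 1 <= `|lam|.
Proof.
move=> lam0 [g1 [g2 [d1 d2 EG [C1 [C2 [D1 [D2 [U1 [U2 [V1 [V2 []]]]]]]]]]]].
move=> [/circle_zeros[M dM ->] _ /circle_zeros[N dN ->] _] [cU1 cU2 cV1 cV2].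
have [M' [dM' -> ->]] := complementary_component_region dM cU1.
have [N' [dN' -> ->]] := complementary_component_region dN cV1.
have sub (K U : set (sphere R)) : complementary_component K U -> U `<=` ~` K.
  by move=> [w _ ->]; exact: connected_component_sub.
exact: paired_discs_bound lam0 d1 d2 EG dM' dN' (sub _ _ cU2) (sub _ _ cV2).
Qed.

(** * Four circles for large parameters *)

(** The converse of [paired_region]. *)
Lemma pairs_region (R : realType) (g M N : 'M[R[i]]_2) : \det g = 1 -> disc M ->
  act g M = - N -> pairs g (zeros M) (region M) (zeros N) (region N).
Proof.
move=> dg dM gMN.
have sgn u : exists c : R, 0 < c /\ hval M (hcoord u) = c * - hval N (hcoord (mobius g u)).
  by have [c [c0 e]] := hval_mobius u dg dM.1; exists c; split => //; rewrite e gMN hvalN.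
split; apply/seteqP; split => w.
- move=> [u uM <-]; have [c [c0 e]] := sgn u; move: uM; rewrite /zeros /= e => /eqP.
  by rewrite mulf_eq0 (gt_eqF c0) oppr_eq0 => /eqP.
- have [u <-] := mobius_surj w dg; have [c [c0 e]] := sgn u => wN; exists u => //.
  by rewrite /zeros /= e wN oppr0 mulr0.
- move=> [u uM <-]; have [c [c0 e]] := sgn u; move: uM; rewrite /region /= e.
  rewrite pmulr_rlt0 // oppr_lt0 => h [|]; rewrite /zeros /region /= => h'.
    by rewrite h' ltxx in h.
  by have := lt_trans h h'; rewrite ltxx.
- have [u <-] := mobius_surj w dg; have [c [c0 e]] := sgn u => wN; exists u => //.
  rewrite /region /= e pmulr_rlt0 // oppr_lt0 lt_neqAle leNgt; apply/andP; split.
    by apply/eqP => h; apply: wN; left.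
  by apply/negP => h; apply: wN; right.
Qed.

Lemma region_component (R : realType) (M : 'M[R[i]]_2) : disc M ->
  complementary_component (zeros M) (region M).
Proof.
move=> dM; have [x x0] := disc_inhabited dM.
have x1 : x != 0 by apply: contraTneq x0 => ->; rewrite /hval !mulmx0 mxE /= ltxx.
have [k [w [k0 xE]]] := hcoord_surj x1.
have Mw : region M w by move: x0; rewrite xE (hvalZ _ _ dM.1) pmulr_rlt0 // ReJ_gt0.
exists w; last by rewrite component_region.
by move=> h; move: Mw; rewrite /region /= h ltxx.
Qed.

(** The disc of radius 1 about [c = 1] or [c = -1] lies in |z| < 2, which misses the
    half-planes at distance |u + i v| >= 2 from 0. *)
Lemma circles_below_strip (R : realType) (x y u v e c : R) : c ^+ 2 = 1 -> e ^+ 2 = 1 ->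
  4 <= u ^+ 2 + v ^+ 2 -> x ^+ 2 + y ^+ 2 < 2 * (c * x) ->
  e * (x * u + y * v) + (u ^+ 2 + v ^+ 2) < 0 -> False.
Proof.
move=> c1 e1 m4 h1 h2.
have s0 : 0 <= x ^+ 2 + y ^+ 2 by rewrite addr_ge0 ?sqr_ge0.
have sx : (c * x) ^+ 2 <= x ^+ 2 + y ^+ 2 by rewrite exprMn c1 mul1r lerDl sqr_ge0.
have s4 : x ^+ 2 + y ^+ 2 < 4.
  by move: s0 sx h1; move: (_ + _) (c * x) => s a; nra.
have cs : (e * (x * u + y * v)) ^+ 2 <= (x ^+ 2 + y ^+ 2) * (u ^+ 2 + v ^+ 2).
  rewrite exprMn e1 mul1r.
  have -> : (x ^+ 2 + y ^+ 2) * (u ^+ 2 + v ^+ 2) = (x * u + y * v) ^+ 2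
    + (x * v - y * u) ^+ 2 by ring.
  by rewrite lerDl sqr_ge0.
move: s0 s4 m4 cs h2; move: (x ^+ 2 + _) (u ^+ 2 + _) (e * _) => s m w; nra.
Qed.

(** The generator [S] maps the inside of |z + 1| = 1 onto the outside of |z - 1| = 1, and
    [T] maps one side of the strip of width [2 |mu|] centred at 0 and orthogonal to [mu] onto
    the exterior of the other side. *)
Lemma classical_T_Schottky_norm_ge2 (R : realType) (mu : R[i]) :
  2 <= `|mu| -> classical_T_Schottky (G_ mu).
Proof.
move=> mu2; have mu0 : mu != 0 by rewrite -normr_gt0 (lt_le_trans _ mu2).
have [] := sqrt_normE mu0; set n := Num.sqrt _ => n0 nE.
have n2 : 2 <= n.
  by move: mu2; rewrite -(rmorph_nat (real_complex R) 2) normc_def lecR; apply.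
clear mu2; have di : 'i%C * mu != 0.
  by rewrite mulf_neq0 // eq_complex /= oner_eq0 andbF.
pose M1 := circle_form (-1 : R[i]) 1; pose M2 := circle_form (1 : R[i]) 1.
pose N1 := - line_form (- mu) ('i%C * mu); pose N2 := line_form mu ('i%C * mu).
have dM1 : disc M1 by exact: disc_circle.
have dM2 : disc M2 by exact: disc_circle.
have dN1 : disc N1 by apply: discN; exact: disc_line.
have dN2 : disc N2 by exact: disc_line.
have nn : Num.sqrt (complex.Re ('i%C * mu) ^+ 2 + complex.Im ('i%C * mu) ^+ 2) = n.
  by rewrite /n; congr Num.sqrt; case: (mu) => ? ? /=; ring.
exists (S_mx R), (T_mx mu); split => //; [exact: (det_S_pow (1 : R))|exact: det_T|].
exists (zeros M1), (zeros M2), (zeros N1), (zeros N2), (region M1), (region M2), (region N1), (region N2).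
have vM (c z : R[i]) : hval (circle_form c 1) (cvec z 1) = complex.Re ((z - c) * (z - c)^*) - 1.
  by rewrite hval_circle invr1 mul1r expr1n.
have vN1 z : hval N1 (cvec z 1) = 2 / n * ((complex.Re z * complex.Re mu
  + complex.Im z * complex.Im mu) + n ^+ 2).
  by rewrite hvalN hval_line nn nE; case: (mu) => ? ?; case: (z) => ? ? /=; ring.
have vN2 z : hval N2 (cvec z 1) = 2 / n * (- (complex.Re z * complex.Re mu
  + complex.Im z * complex.Im mu) + n ^+ 2).
  by rewrite hval_line nn nE; case: (mu) => ? ?; case: (z) => ? ? /=; ring.
have m2 : 4 <= n ^+ 2 by rewrite expr2; nra.
have sep (A B : set (sphere R)) : (forall z, A (Some z) -> B (Some z) -> False) ->
    ~ A None \/ ~ B None -> [disjoint A & B].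
  move=> h hn; apply/disj_set2P/seteqP; split => // -[z [Az Bz]|[An Bn]]; first exact: h Az Bz.
  by case: hn.
split.
- split; rewrite /N1 ?zerosN.
  + by left; exists (-1), 1; rewrite zeros_circle.
  + by left; exists 1, 1; rewrite zeros_circle.
  + by right; exists (- mu), ('i%C * mu); rewrite zeros_line.
  + by right; exists mu, ('i%C * mu); rewrite zeros_line.
- by split; apply: region_component.
- have inv0 : 0 < 2 / n by rewrite divr_gt0.
  have R1 z : region M1 (Some z) -> complex.Re z ^+ 2 + complex.Im z ^+ 2 < 2 * (-1 * complex.Re z).
    by rewrite /region /= vM; case: (z) => ? ? /=; lra.
  have R2 z : region M2 (Some z) -> complex.Re z ^+ 2 + complex.Im z ^+ 2 < 2 * (1 * complex.Re z).
    by rewrite /region /= vM; case: (z) => ? ? /=; lra.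
  have L1 z : region N1 (Some z) -> 1 * (complex.Re z * complex.Re mu
    + complex.Im z * complex.Im mu) + n ^+ 2 < 0.
    by rewrite /region /= vN1 pmulr_rlt0 // mul1r.
  have L2 z : region N2 (Some z) -> -1 * (complex.Re z * complex.Re mu
    + complex.Im z * complex.Im mu) + n ^+ 2 < 0.
    by rewrite /region /= vN2 pmulr_rlt0 // mulN1r.
  have m1 : ~ region M1 None.
    by rewrite /region /= hval_circle_infty invr1; apply/negP; rewrite -leNgt.
  have m2' : ~ region M2 None.
    by rewrite /region /= hval_circle_infty invr1; apply/negP; rewrite -leNgt.
  have l1 : ~ region N1 None.
    by rewrite /region /= hvalN hval_line_infty oppr0 ltxx.
  have s1 : (-1) ^+ 2 = 1 :> R by rewrite sqrrN expr1n.
  have s2 : 1 ^+ 2 = 1 :> R by rewrite expr1n.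
  rewrite nE in m2 L1 L2.
  split; [apply: sep; [|by left]|apply: sep; [|by left]|split; apply: sep; try by left].
  + move=> z /R1 h1 /R2 h2; have := sqr_ge0 (complex.Re z); have := sqr_ge0 (complex.Im z); lra.
  + by move=> z /L1 h1 /L2 h2; lra.
  + by move=> z /R1 h1 /L1 h2; exact: (circles_below_strip s1 s2 m2 h1 h2).
  + by move=> z /R1 h1 /L2 h2; exact: (circles_below_strip s1 s1 m2 h1 h2).
  + by move=> z /R2 h1 /L1 h2; exact: (circles_below_strip s2 s2 m2 h1 h2).
  + by move=> z /R2 h1 /L2 h2; exact: (circles_below_strip s2 s1 m2 h1 h2).
- apply: pairs_region => //; first exact: det_S_pow (1 : R).
  have -> : M1 = mx22 1%:C (1 +i* 0) (1 -i* 0) 0%:C.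
    rewrite /M1 /circle_form invr1; apply: matrix2P; rewrite !mx22E; apply/eqP;
      rewrite eq_complex /=;
    by apply/andP; split; apply/eqP; ring.
  rewrite -S_pow1 act_S /M2 /circle_form invr1; apply: matrix2P; rewrite !mxE /=; apply/eqP;
    rewrite eq_complex /=;
    by apply/andP; split; apply/eqP; ring.
- apply: pairs_region => //; first exact: det_T.
  have n0' : n != 0 by rewrite gt_eqF.
  have E p : line_form p ('i%C * mu) = mx22 0%:C (- (complex.Re mu / n) +i* - (complex.Im mu / n))
      (- (complex.Re mu / n) -i* - (complex.Im mu / n))
      (2 * (complex.Re p * complex.Re mu + complex.Im p * complex.Im mu) / n)%:C.
    rewrite /line_form nn; case: (mu) => x y; case: p => u v /=.
    by apply: matrix2P; rewrite !mxE /=; apply/eqP; rewrite eq_complex /=; apply/andP; split;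
      apply/eqP; field.
  rewrite /N1 /N2 !E actN act_T; move: nE; case: (mu) => x y /= nE.
  apply: matrix2P; rewrite !mxE /=; apply/eqP; rewrite eq_complex /=; apply/andP; split;
    apply/eqP; by ring.
Qed.

(** * Non-discreteness for small parameters *)

(** The modulus as a real number, where linear arithmetic over an ordered field applies. *)
Definition modc (R : realType) (z : R[i]) : R := complex.Re `|z|.

Lemma modcE (R : realType) (z : R[i]) : `|z| = (modc z)%:C.
Proof. by rewrite /modc RRe_real // normr_real. Qed.

Lemma modc_ge0 (R : realType) (z : R[i]) : 0 <= modc z.
Proof. by rewrite -ler0c -modcE normr_ge0. Qed.

Lemma modcM (R : realType) (x y : R[i]) : modc (x * y) = modc x * modc y.
Proof. by apply: complexI; rewrite rmorphM /= -!modcE normrM. Qed.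

Lemma modcN (R : realType) (x : R[i]) : modc (- x) = modc x.
Proof. by rewrite /modc normrN. Qed.

Lemma modcD (R : realType) (x y : R[i]) : modc (x + y) <= modc x + modc y.
Proof. by rewrite -lecR rmorphD /= -!modcE ler_normD. Qed.

Lemma modc0 (R : realType) : modc 0 = 0 :> R.
Proof. by rewrite /modc normr0. Qed.

Lemma modc_nat (R : realType) n : modc n%:R = n%:R :> R.
Proof. by apply: complexI; rewrite -modcE normr_nat (rmorph_nat (real_complex R) n). Qed.

Lemma modc1 (R : realType) : modc 1 = 1 :> R.
Proof. exact: (modc_nat R 1). Qed.

Lemma pow_small (R : realType) (q e : R) : 0 <= q -> q < 1 -> 0 < e -> exists n, q ^+ n < e.
Proof.
move=> q0 q1 e0; have : (GRing.exp q : R^nat) @ \oo --> (0 : R).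
  by apply: cvg_expr; rewrite ger0_norm.
move/cvgrPdist_lt => /(_ e e0) [n _ /(_ n (leqnn n))] /=.
by rewrite sub0r normrN ger0_norm ?exprn_ge0 // => h; exists n.
Qed.

(** One step of the recursion [A -> A T A^-1]: the lower left entry [c] becomes [- c^2 t],
    and the upper left entry comes close to 1 when [c] is small. *)
Lemma conj_of_T (R : realType) (a b c d t lam : R[i]) : a * d - b * c = 1 -> t = 2 * lam ->
  mx22 a b c d *m T_mx lam *m invmx (mx22 a b c d) =
  mx22 (1 - a * c * t) (a ^+ 2 * t) (- (c ^+ 2 * t)) (1 + a * c * t).
Proof.
move=> D tE; have u : mx22 a b c d \in unitmx by apply: unit_det1; rewrite det22 !mx22E.
have -> : invmx (mx22 a b c d) = mx22 d (- b) (- c) a.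
  apply: (can_inj (mulKmx u)); rewrite mulmxV // mulmx22 -mx22_1 -D.
  by congr mx22; ring.
by rewrite !mulmx22 -tE -[in RHS]D; congr mx22; ring.
Qed.

(** With [t = 2 lam] and [q = |t| < 1], the entry [c_n] of the [n]-th iterate satisfies
    [|c_n| <= q^n] and never vanishes, while [a_n] stays bounded by [K = 1 / (1 - q)].  Hence
    the iterates are different from [T] and converge to it. *)
Lemma small_not_discrete (R : realType) (lam : R[i]) : lam != 0 -> modc lam < 1 / 2 ->
  ~ PSL2_discrete (G_ lam).
Proof.
move=> lam0 lam1; have [_ _ GM GV _] := generated_group (det_S_pow (1 : R)) (det_T lam).
have gS : G_ lam (S_mx R) by move=> A [_ ]; apply; left.
have gT : G_ lam (T_mx lam) by move=> A [_ ]; apply; right.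
move=> /(_ _ gT) [_ [V /nbhs_ballP[_ /gt0_complexE[e e0 ->] Ve] VG]].
have [t tE] : exists t, t = 2 * lam by eexists.
have t0 : t != 0 by rewrite tE mulf_neq0 // pnatr_eq0.
have q0 := modc_ge0 t; have q1 : modc t < 1 by rewrite tE modcM modc_nat; lra.
move: q0 q1; set q := modc t => q0 q1.
pose K := (1 - q)^-1.
have q1' : 1 - q != 0 by rewrite subr_eq0 gt_eqF.
have K0 : 0 < K by rewrite invr_gt0 subr_gt0.
have KE : 1 + K * q = K by rewrite /K; field.
have K1 : 1 <= K by rewrite -KE lerDl mulr_ge0 // ltW.
have step (a c : R[i]) n : modc c <= q ^+ n -> modc a <= K -> modc (a * c * t) <= K * q ^+ n.+1.
  move=> cq aK; rewrite !modcM -/q exprSr mulrA; apply: ler_wpM2r => //.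
  by apply: ler_pM => //; exact: modc_ge0.
have step' (c : R[i]) n : modc c <= q ^+ n -> modc (c ^+ 2 * t) <= q ^+ n.+1.
  move=> cq; rewrite expr2 !modcM -/q exprSr; apply: ler_wpM2r => //.
  have q1n : q ^+ n <= 1 by rewrite exprn_ile1 // ltW.
  have c0 := modc_ge0 c; have c1 := le_trans cq q1n.
  by apply: le_trans _ cq; rewrite -[leRHS]mulr1; exact: ler_wpM2l.
have seq n : exists a b c d, [/\ G_ lam (mx22 a b c d), a * d - b * c = 1, c != 0,
    modc c <= q ^+ n & modc (a - 1) <= K * q ^+ n /\ modc a <= K].
  elim: n => [|n [a [b [c [d [gA dA c0 cq [_ aK]]]]]]].
    exists 1, 0, 1, 1; split; [exact: gS|by ring|exact: oner_neq0|by rewrite modc1|].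
    by rewrite subrr modc0 modc1 expr0 mulr1 (ltW K0).
  exists (1 - a * c * t), (a ^+ 2 * t), (- (c ^+ 2 * t)), (1 + a * c * t); split.
  - by rewrite -(conj_of_T dA tE); exact: (GM _ _ (GM _ _ gA gT) (GV _ gA)).
  - by ring.
  - by rewrite oppr_eq0 mulf_neq0 // expf_neq0.
  - by rewrite modcN; exact: step'.
  - rewrite addrAC subrr sub0r modcN; split; first exact: step.
    apply: le_trans (modcD _ _) _; rewrite modcN modc1 -KE lerD2l.
    apply: le_trans (step _ _ _ cq aK) _; apply: ler_wpM2l; first exact: ltW.
    by rewrite exprS; apply: ler_piMr => //; apply: exprn_ile1 => //; exact: ltW.
pose B := K * (K + 1).
have B0 : 0 < B by rewrite mulr_gt0 // addr_gt0.
have [n qn] := pow_small q0 q1 (divr_gt0 e0 B0).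
have {}qn : B * q ^+ n < e by rewrite mulrC -ltr_pdivlMr.
have [a [b [c [d [gA dA c0 cq [a1 aK]]]]]] := seq n.
pose A := mx22 (1 - a * c * t) (a ^+ 2 * t) (- (c ^+ 2 * t)) (1 + a * c * t).
have gA' : G_ lam A.
  by rewrite /A -(conj_of_T dA tE); exact: (GM _ _ (GM _ _ gA gT) (GV _ gA)).
have : (V `&` G_ lam) A.
  split => //; apply: Ve; split; first by rewrite ltcR.
  have near (x y : R[i]) : modc (x - y) <= B * q ^+ n -> ball (x : (R[i])^o) e%:C (y : (R[i])^o).
    by move=> h; rewrite -ball_normE /= modcE ltcR; exact: le_lt_trans qn.
  have qn0 : 0 <= q ^+ n by rewrite exprn_ge0.
  have KB : K <= B by rewrite ler_peMr ?lerDr // ltW.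
  have c_small := step _ _ _ cq aK.
  have qS : q ^+ n.+1 <= q ^+ n.
    by rewrite exprS -[leRHS]mul1r; apply: ler_wpM2r => //; exact: ltW.
  have KqB : K * q ^+ n <= B * q ^+ n by exact: ler_wpM2r.
  have KqS : K * q ^+ n.+1 <= K * q ^+ n by apply: ler_wpM2l => //; exact: ltW.
  have act_le := le_trans c_small (le_trans KqS KqB).
  have entry00 : modc (1 - (1 - a * c * t)) <= B * q ^+ n by rewrite opprB addrC subrK.
  have entry11 : modc (1 - (1 + a * c * t)) <= B * q ^+ n.
    by rewrite opprD addrA subrr sub0r modcN.
  have entry10 : modc (0 - - (c ^+ 2 * t)) <= B * q ^+ n.
    rewrite sub0r opprK; apply: le_trans (step' _ _ cq) (le_trans qS _).
    by rewrite -[leLHS]mul1r; apply: ler_wpM2r => //; exact: le_trans KB.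
  have entry01 : modc (t - a ^+ 2 * t) <= B * q ^+ n.
    have -> : t - a ^+ 2 * t = - ((a - 1) * (a + 1) * t) by ring.
    rewrite modcN !modcM -/q.
    have a2 : modc (a + 1) <= K + 1.
      by apply: le_trans (modcD _ _) _; rewrite modc1 lerD2r.
    have h1 : modc (a - 1) * modc (a + 1) <= K * q ^+ n * (K + 1).
      by apply: ler_pM => //; exact: modc_ge0.
    have h0 : 0 <= modc (a - 1) * modc (a + 1) by rewrite mulr_ge0 ?modc_ge0.
    apply: le_trans (_ : modc (a - 1) * modc (a + 1) * 1 <= _).
      by apply: ler_wpM2l => //; exact: ltW.
    by rewrite mulr1 /B mulrAC.
  move=> i j; apply: near; rewrite /A /T_mx -tE.
  by case: i => [[|[|k]] Hi] //; case: j => [[|[|l]] Hj] //; rewrite !mxE.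
rewrite VG => /(congr1 (fun M : 'M[R[i]]_2 => M 1 0)); rewrite /A !mx22E => /eqP.
by rewrite oppr_eq0 mulf_eq0 (negPf t0) orbF expf_eq0 /= (negPf c0).
Qed.

(** * Iteration of the squaring map *)

Lemma modc_f (R : realType) (z : R[i]) : modc (f z) = 2 * modc z ^+ 2.
Proof. by rewrite /f modcM modcN modc_nat expr2 modcM -expr2. Qed.

Lemma iter_f_neq0 (R : realType) (z : R[i]) n : z != 0 -> iter n (@f R) z != 0.
Proof.
by move=> z0; elim: n => [//|n IH]; rewrite iterS /f mulf_neq0 ?expf_neq0 // oppr_eq0 pnatr_eq0.
Qed.

Lemma modc_iter_small (R : realType) (z : R[i]) n : modc z < 1 / 2 ->
  modc (iter n (@f R) z) < 1 / 2.
Proof.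
move=> h; elim: n => [//|n IH]; rewrite iterS modc_f expr2.
by have := modc_ge0 (iter n (@f R) z); nra.
Qed.

(** The numbers [2 |f^n z|] start above [1 + d] with [d > 0] and are squared at each step,
    so they increase by at least [d]. *)
Lemma modc_iter_large (R : realType) (z : R[i]) : 1 / 2 < modc z ->
  exists n, 2 <= modc (iter n (@f R) z).
Proof.
move=> h; pose d := 2 * modc z - 1; have d0 : 0 < d by rewrite /d; lra.
have grow n : 1 + d + n%:R * d <= 2 * modc (iter n (@f R) z).
  elim: n => [|n IH]; first by rewrite mul0r addr0 /d /=; lra.
  rewrite iterS modc_f -natr1 mulrDl mul1r expr2.
  have nd : 0 <= n%:R * d by rewrite mulr_ge0 // ltW.
  move: IH nd d0; move: (n%:R * d) (modc (iter n (@f R) z)) => x y; move: d => e IH nd e0; nra.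
pose n := Num.bound (3 / d); exists n.
have : 3 / d < n%:R by apply: archi_boundP; rewrite divr_ge0 // ltW.
rewrite ltr_pdivrMr // => nd; have := grow n; lra.
Qed.

Theorem theorem6p2 (R : realType) (lam : R[i]) (lam_neq0 : lam != 0) :
  [/\ `|lam| < 1 / 2 ->
        [/\ forall n : nat, `|iter n (@f R) lam| < 1 / 2,
            ~ PSL2_discrete (G_ (f lam)) &
            forall n : nat, (0 < n)%N ->
              ~ PSL2_discrete (G_ (iter n (@f R) lam)) /\
              ~ classical_T_Schottky (G_ (iter n (@f R) lam))],
      `|lam| > sqrtC 2 / 2 ->
        [/\ `|f lam| > 1, `|f (f lam)| > 2 &
            classical_T_Schottky (G_ (f (f lam)))],
      1 / 2 < `|lam| < sqrtC 2 / 2 ->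
        exists n : nat,
          [/\ (1 <= n)%N,
              classical_T_Schottky (G_ (iter n (@f R) lam)) /\
                ~ classical_T_Schottky (G_ (iter n.-1 (@f R) lam)) &
              forall m : nat, (1 <= m)%N ->
                classical_T_Schottky (G_ (iter m (@f R) lam)) ->
                ~ classical_T_Schottky (G_ (iter m.-1 (@f R) lam)) ->
                (n <= m)%N] &
      1 / 2 < `|lam| < sqrtC 2 / 2 ->
        exists! n : nat, nth_classical_T_Schottky lam n].

Proof.
have halfE : 1 / 2 = (1 / 2 : R)%:C :> R[i].
  by rewrite rmorphM /= fmorphV /= (rmorph_nat (real_complex R) 2).
have ltmod (z : R[i]) (r : R) : (`|z| < r%:C) = (modc z < r) by rewrite modcE ltcR.
have gtmod (z : R[i]) (r : R) : (r%:C < `|z|) = (r < modc z) by rewrite modcE ltcR.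
have natC n : n%:R = (n%:R : R)%:C :> R[i] by rewrite (rmorph_nat (real_complex R) n).
have oneC : 1 = (1 : R)%:C :> R[i] by rewrite (rmorph1 (real_complex R)).
have small1 (z : R[i]) : z != 0 -> classical_T_Schottky (G_ z) -> 1 <= modc z.
  by move=> z0 /(classical_T_Schottky_norm_ge1 z0); rewrite modcE oneC lecR.
have large (z : R[i]) : 2 <= modc z -> classical_T_Schottky (G_ z).
  by move=> h; apply: classical_T_Schottky_norm_ge2; rewrite modcE (natC 2%N) lecR.
pose s := modc (sqrtC 2 : R[i]).
have sE : sqrtC 2 = s%:C :> R[i].
  by rewrite -modcE ger0_norm // sqrtC_ge0 (natC 2%N) lecR.
have s2 : s ^+ 2 = 2.
  by apply: complexI; rewrite rmorphXn /= -sE sqrtCK (natC 2%N).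
have shalf : sqrtC 2 / 2 = (s / 2)%:C :> R[i].
  by rewrite sE rmorphM /= fmorphV /= (rmorph_nat (real_complex R) 2).
have s0 : 0 <= s by exact: modc_ge0.
have not_small (z : R[i]) : z != 0 -> modc z < 1 -> ~ classical_T_Schottky (G_ z).
  by move=> z0 z1 /(small1 _ z0); rewrite leNgt z1.
have s_lt2 : s < 2 by nra.
have mono k : classical_T_Schottky (G_ (iter k (@f R) lam)) ->
    classical_T_Schottky (G_ (iter k.+1 (@f R) lam)).
  move=> /(small1 _ (iter_f_neq0 _ lam_neq0)) h; apply: large; rewrite iterS modc_f expr2; nra.
have mono' k j : (k <= j)%N -> classical_T_Schottky (G_ (iter k (@f R) lam)) ->
    classical_T_Schottky (G_ (iter j (@f R) lam)).
  by move=> /subnK <- hk; elim: (j - k)%N => // i IH; rewrite addSn; exact: mono.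
have transition : 1 / 2 < `|lam| < sqrtC 2 / 2 -> exists n : nat,
    [/\ (1 <= n)%N, classical_T_Schottky (G_ (iter n (@f R) lam)),
      ~ classical_T_Schottky (G_ (iter n.-1 (@f R) lam)) &
      forall m, classical_T_Schottky (G_ (iter m (@f R) lam)) -> (n <= m)%N].
  rewrite halfE shalf gtmod ltmod => /andP[l1 l2].
  have n0 : ~ classical_T_Schottky (G_ lam) by apply: not_small => //; lra.
  have [N hN] := modc_iter_large l1.
  have ex : exists n, `[< classical_T_Schottky (G_ (iter n (@f R) lam)) >].
    by exists N; apply/asboolP; exact: large.
  have [n /asboolP Pn nmin] := ex_minnP ex.
  have n1 : (0 < n)%N by case: n Pn {nmin}.
  exists n; split => //; last by move=> m Pm; apply: nmin; exact/asboolP.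
  by move=> Pn1; have := nmin n.-1 (asboolT Pn1); rewrite -ltnS prednK // ltnn.
split.
- rewrite halfE ltmod => l1; have it n : modc (iter n (@f R) lam) < 1 / 2 by exact: modc_iter_small.
  split.
  + by move=> n; rewrite ltmod.
  + by apply: small_not_discrete; [exact: (iter_f_neq0 1 lam_neq0)|exact: (it 1%N)].
  + move=> n _; split; first by apply: small_not_discrete; [exact: iter_f_neq0|exact: it].
    by apply: not_small; [exact: iter_f_neq0|have := it n; lra].
- rewrite shalf gtmod => l1.
  have f1 : 1 < modc (f lam) by rewrite modc_f expr2; nra.
  have f2 : 2 < modc (f (f lam)) by rewrite modc_f expr2; nra.
  by split; [rewrite oneC gtmod|rewrite (natC 2%N) gtmod|apply: large; exact: ltW].
- move=> /transition[n [n1 Pn Pn1 nmin]]; exists n; split => // m _ Pm _; exact: nmin.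
- move=> /transition[n [n1 Pn Pn1 nmin]]; exists n; split => // m [m1 Pm Pm1].
  apply/eqP; rewrite eqn_leq nmin //= leqNgt; apply/negP => nm.
  by apply: Pm1; apply: mono' Pn; rewrite -ltnS prednK.
Qed.
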